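(* Let $\mathcal{G}: A_G=\bigoplus_{g\in G}A_g$ be a $G$-graded algebra over a field $\mathbb{F}$ and let $M$ be a left $A_e$-module. Then $\mathcal{I}_{\mathcal{G}}(M)=\mathcal{I}_{\alpha(\mathcal{G})}(M)$ for every $\alpha\in Z^2(G,\mathbb{F}^* )$. In particular, $M$ is $G$-invariant with respect to $\mathcal{G}$ if and only if it is $G$-invariant with respect to $\alpha(\mathcal{G})$. Consequently, $\mathrm{Irr}_{\mathbb{F}}(A_e)^{\mathcal{G}}=\mathrm{Irr}_{\mathbb{F}}(A_e)^{\alpha(\mathcal{G})}$ for every $\alpha\in Z^2(G,\mathbb{F}^* )$.
   Context: Algebras are associative and unital. A $G$-graded $\mathbb{F}$-algebra is $A_G=\bigoplus_{g\in G}A_g$ with $A_gA_h\subseteq A_{gh}$; $A_e$ is its base algebra. A $G$-graded left $A_G$-module is $W_G=\bigoplus_gW_g$ with $A_gW_h\subseteq W_{gh}$; $\stackrel{G}{\cong}$ denotes degree-preserving isomorphism. For $\alpha\in Z^2(G,\mathbb{F}^* )$ (trivial action), $\mathbb{F}^{\alpha}G=\bigoplus_g\mathbb{F}v_g$, $v_gv_h=\alpha(g,h)v_{gh}$, and the twisted graded algebra $\alpha(\mathcal{G})$ is $\alpha(A_G)=\bigoplus_g\mathbb{F}v_g\otimes_{\mathbb{F}}A_g\subseteq\mathbb{F}^{\alpha}G\otimes_{\mathbb{F}}A_G$; its base algebra is identified with $A_e$ via $x\mapsto1\otimes x$, so $A_e$-modules are regarded as modules over the base algebra of $\alpha(A_G)$.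 For an $A_e$-module $M$, $A_G\overline{\otimes}_{A_e}M:=(A_G\otimes_{A_e}M)/t$, where $(A_G\otimes_{A_e}M)_g=A_g\otimes_{A_e}M$ and $t$ is the largest graded submodule with zero $e$-component. The suspension $h(W_G)$ is the same module regraded by $h(W_G)_g:=W_{gh}$. The inertia is $\mathcal{I}_{\mathcal{G}}(M)=\{g\in G:A_G\overline{\otimes}_{A_e}M\stackrel{G}{\cong}g(A_G\overline{\otimes}_{A_e}M)\}$ (isomorphism of graded $A_G$-modules); $\mathcal{I}_{\alpha(\mathcal{G})}(M)$ is defined likewise with $\alpha(A_G)$ in place of $A_G$. $M$ is $G$-invariant with respect to $\mathcal{G}$ if $\mathcal{I}_{\mathcal{G}}(M)=G$. $\mathrm{Irr}_{\mathbb{F}}(A_e)$ is the set of isomorphism classes of simple $A_e$-modules $M$ with $\mathrm{End}_{A_e}(M)=\mathbb{F}\cdot\mathrm{Id}_M$, and $\mathrm{Irr}_{\mathbb{F}}(A_e)^{\mathcal{G}}$ is its subset of classes $G$-invariant with respect to $\mathcal{G}$. *)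

(* Defs.v *)
From HB Require Import structures.
From mathcomp Require Import all_boot all_algebra finmap.
From mathcomp Require Import boolp classical_sets.
From mathcomp Require Import monalg.

Set Implicit Arguments.
Unset Strict Implicit.
Unset Printing Implicit Defensive.

Import GRing.Theory.
Local Open Scope ring_scope.

Section ZmodMorphism.
Variables (U V : zmodType) (h : U -> V).
Hypothesis hB : zmod_morphism h.

Lemma zmorph0 : h 0 = 0.
Proof. by rewrite -[X in h X](subrr 0) hB subrr. Qed.
Lemma zmorphN x : h (- x) = - h x.
Proof. by rewrite -sub0r hB zmorph0 sub0r. Qed.
Lemma zmorphD x y : h (x + y) = h x + h y.
Proof. by rewrite -{1}[y]opprK hB zmorphN opprK. Qed.
Lemma zmorph_sum I (s : seq I) (P : pred I) (f : I -> U) :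
  h (\sum_(i <- s | P i) f i) = \sum_(i <- s | P i) h (f i).
Proof. by apply: big_morph; [exact: zmorphD | exact: zmorph0]. Qed.
End ZmodMorphism.

Lemma zmorph_sub (U V : zmodType) (f g : U -> V) :
  zmod_morphism f -> zmod_morphism g -> zmod_morphism (fun x => f x - g x).
Proof. by move=> fB gB x y; rewrite fB gB !opprD !opprK addrACA. Qed.
Lemma zmorph_add (U V : zmodType) (f g : U -> V) :
  zmod_morphism f -> zmod_morphism g -> zmod_morphism (fun x => f x + g x).
Proof. by move=> fB gB x y; rewrite fB gB opprD addrACA. Qed.
Lemma zmorph_comp (U V W : zmodType) (f : V -> W) (g : U -> V) :
  zmod_morphism f -> zmod_morphism g -> zmod_morphism (fun x => f (g x)).
Proof. by move=> fB gB x y; rewrite gB fB. Qed.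

Section Span.
Variable V : zmodType.

(* The subgroup generated by X. *)
Definition zspan (X : set V) : {pred V} := fun v =>
  `[< forall S : {pred V}, GRing.zmod_closed S ->
        (forall x, X x -> x \in S) -> v \in S >].

Lemma zspanP (X : set V) v : reflect (forall S : {pred V},
  GRing.zmod_closed S -> (forall x, X x -> x \in S) -> v \in S) (v \in zspan X).
Proof. exact: asboolP. Qed.

Lemma zspan_closed X : GRing.zmod_closed (zspan X).
Proof.
split; first by apply/zspanP => S [].
move=> x y /zspanP xX /zspanP yX; apply/zspanP => S S_cl XS.
by case: (S_cl) => _; apply; [exact: xX | exact: yX].
Qed.

HB.instance Definition _ X := GRing.isZmodClosed.Build V (zspan X) (zspan_closed X).

Lemma zspan_gen (X : set V) x : X x -> x \in zspan X.
Proof. by move=> Xx; apply/zspanP => S _; apply. Qed.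

Lemma zspan_ind (X : set V) (P : V -> Prop) :
    P 0 -> (forall x y, P x -> P y -> P (x - y)) -> (forall x, X x -> P x) ->
  forall x, x \in zspan X -> P x.
Proof.
move=> P0 PB PX x /zspanP/(_ (fun v => `[< P v >])) xP.
apply/asboolP/xP.
  split; first exact/asboolP.
  by move=> u v /asboolP Pu /asboolP Pv; apply/asboolP/PB.
by move=> y /PX Py; apply/asboolP.
Qed.
End Span.

Section MalgLift.
Variables (K : choiceType) (C Z : zmodType) (f : K -> C -> Z).
Hypothesis fB : forall k, zmod_morphism (f k).

Definition mlift (x : {malg C[K]}) : Z := \sum_(k <- msupp x) f k x@_k.

Lemma mliftEw (d : {fset K}) x : (msupp x `<=` d)%fset ->
  mlift x = \sum_(k <- d) f k x@_k.
Proof.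
move=> le; apply: big_fset_incl le _ => k _ /mcoeff_outdom ->; exact: zmorph0.
Qed.

Lemma mliftB : zmod_morphism mlift.
Proof.
move=> x y; pose d := (msupp x `|` msupp y)%fset.
rewrite (@mliftEw d (x - y)) ?msuppB_le // (@mliftEw d x) ?fsubsetUl //.
rewrite (@mliftEw d y) ?fsubsetUr // -sumrB.
by apply: eq_bigr => k _; rewrite mcoeffB fB.
Qed.

Lemma mliftU k c : mlift << c *g k >> = f k c.
Proof.
by rewrite (@mliftEw [fset k]%fset) ?msuppU_le // big_seq_fset1 mcoeffUU.
Qed.
End MalgLift.

Lemma malg_ext (K : choiceType) (C Z : zmodType) (f g : {malg C[K]} -> Z) :
    zmod_morphism f -> zmod_morphism g ->
    (forall k c, f << c *g k >> = g << c *g k >>) ->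
  f =1 g.
Proof.
move=> fB gB fg x; rewrite [x]monalgE (zmorph_sum fB) (zmorph_sum gB).
by apply: eq_bigr => k _.
Qed.

Section Tensor.
Variables (R : Type) (N M : zmodType).
Variables (ract : N -> R -> N) (lact : R -> M -> M).

Inductive tensor_rel : set {malg int[(N * M)%type]} :=
| TensorDl n n' m : tensor_rel (<< (n + n', m) >> - (<< (n, m) >> + << (n', m) >>))
| TensorDr n m m' : tensor_rel (<< (n, m + m') >> - (<< (n, m) >> + << (n, m') >>))
| TensorBal n r m : tensor_rel (<< (ract n r, m) >> - << (n, lact r m) >>).

(* N (x)_R M for a right R-action ract on N and a left R-action lact on M:
   the free abelian group on N * M modulo biadditivity and balancedness. *)
Definition tensor := Quotient.quot (zspan tensor_rel).
HB.instance Definition _ := GRing.Zmodule.on tensor.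

(* The pure tensor n (x) m; locked for performance only. *)
Definition tens : N -> M -> tensor := locked (fun n m =>
  \pi_(Quotient.quot (zspan tensor_rel))%qT << (n, m) >>).

Local Notation pi := (\pi_(Quotient.quot (zspan tensor_rel))%qT).
Local Notation "n # m" := (tens n m) (at level 40).

Lemma tensE n m : n # m = pi << (n, m) >>.
Proof. by rewrite /tens -lock. Qed.

Lemma tpiB : zmod_morphism (pi : _ -> tensor).
Proof. by move=> x y; rewrite raddfB. Qed.

Lemma tpi_rel x : tensor_rel x -> pi x = 0 :> tensor.
Proof.
move=> xr; have -> : (0 : tensor) = pi 0 by rewrite raddf0.
by apply/eqP; rewrite -Quotient.idealrBE subr0 zspan_gen.
Qed.

Lemma tensDl n n' m : (n + n') # m = n # m + n' # m.
Proof.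
have := tpi_rel (TensorDl n n' m); rewrite raddfB raddfD /= -!tensE => /eqP.
by rewrite subr_eq0 => /eqP.
Qed.

Lemma tensDr n m m' : n # (m + m') = n # m + n # m'.
Proof.
have := tpi_rel (TensorDr n m m'); rewrite raddfB raddfD /= -!tensE => /eqP.
by rewrite subr_eq0 => /eqP.
Qed.

Lemma tens_bal n r m : (ract n r) # m = n # (lact r m).
Proof.
have := tpi_rel (TensorBal n r m); rewrite raddfB /= -!tensE => /eqP.
by rewrite subr_eq0 => /eqP.
Qed.

Lemma tens0l m : 0 # m = 0.
Proof. by apply: (addIr (0 # m)); rewrite -tensDl !add0r. Qed.
Lemma tens0r n : n # 0 = 0.
Proof. by apply: (addIr (n # 0)); rewrite -tensDr !add0r. Qed.
Lemma tensNl n m : (- n) # m = - (n # m).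
Proof. by apply: (addIr (n # m)); rewrite -tensDl !addNr tens0l. Qed.
Lemma tensNr n m : n # (- m) = - (n # m).
Proof. by apply: (addIr (n # m)); rewrite -tensDr !addNr tens0r. Qed.
Lemma tensBl n n' m : (n - n') # m = n # m - n' # m.
Proof. by rewrite tensDl tensNl. Qed.
Lemma tensBr n m m' : n # (m - m') = n # m - n # m'.
Proof. by rewrite tensDr tensNr. Qed.

Lemma tens_ind (P : tensor -> Prop) :
    P 0 -> (forall x y, P x -> P y -> P (x - y)) -> (forall n m, P (n # m)) ->
  forall t, P t.
Proof.
move=> P0 PB PT t.
have PN x : P x -> P (- x) by move=> Px; rewrite -sub0r; exact: PB.
have PD x y : P x -> P y -> P (x + y).
  by move=> Px Py; rewrite -[y]opprK; apply: PB => //; exact: PN.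
have Pn x n : P x -> P (x *+ n).
  by move=> Px; elim: n => [|n IHn]; rewrite ?mulr0n // mulrS; exact: PD.
rewrite -[t]reprK [repr t]monalgE raddf_sum /=.
elim/big_rec: _ => // -[n m] x _ Px; apply: PD => //.
have -> z : << z *g (n, m) >> = << (n, m) >> *~ z :> {malg int[(N * M)%type]}.
  rewrite -{1}[z]intz.
  by case: z => k; rewrite ?NegzE ?mulrNz ?monalgUN -?pmulrn monalgUMn.
rewrite raddfMz /=; move: (repr t)@__ => z.
by case: z => k; rewrite ?NegzE ?mulrNz -?pmulrn; [|apply: PN];
  apply: Pn; rewrite -tensE; exact: PT.
Qed.

Lemma tens_ext (Z : zmodType) (f g : tensor -> Z) :
    zmod_morphism f -> zmod_morphism g -> (forall n m, f (n # m) = g (n # m)) ->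
  f =1 g.
Proof.
move=> fB gB fg; apply: tens_ind => // [|x y fgx fgy]; first by rewrite !zmorph0.
by rewrite fB gB fgx fgy.
Qed.

Section Lift.
Variables (Z : zmodType) (f : N -> M -> Z).

Definition balanced := [/\ forall m, zmod_morphism (f^~ m),
  forall n, zmod_morphism (f n) & forall n r m, f (ract n r) m = f n (lact r m)].

Let flift : {malg int[(N * M)%type]} -> Z := mlift (fun nm z => f nm.1 nm.2 *~ z).

(* The additive map n (x) m |-> f n m, for a balanced map f; locked for
   performance only. *)
Definition tlift : tensor -> Z := locked (fun t => flift (repr t)).

Hypothesis fbal : balanced.

Let fliftB : zmod_morphism flift.
Proof. by apply: mliftB => k x y; rewrite mulrzBr. Qed.

Let fliftU n m : flift << (n, m) >> = f n m.
Proof. by rewrite /flift mliftU // => k x y; rewrite mulrzBr. Qed.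

Let flift_rel x : x \in zspan tensor_rel -> flift x = 0.
Proof.
have [fl fr fb] := fbal.
move: x; apply: zspan_ind => [|x y x0 y0|_ [n n' m|n m m'|n r m]].
- exact: zmorph0.
- by rewrite fliftB x0 y0 subr0.
- by rewrite fliftB (zmorphD fliftB) !fliftU (zmorphD (fl m)) subrr.
- by rewrite fliftB (zmorphD fliftB) !fliftU (zmorphD (fr n)) subrr.
- by rewrite fliftB !fliftU fb subrr.
Qed.

Let tlift_pi x : tlift (pi x) = flift x.
Proof.
rewrite /tlift -lock.
apply/eqP; rewrite -subr_eq0 -fliftB flift_rel // Quotient.idealrBE.
by rewrite reprK.
Qed.

Lemma tliftB : zmod_morphism tlift.
Proof.
by move=> x y; rewrite -[x]reprK -[y]reprK -raddfB !tlift_pi fliftB.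
Qed.

Lemma tliftE n m : tlift (n # m) = f n m.
Proof. by rewrite tensE tlift_pi fliftU. Qed.
End Lift.
End Tensor.

Section DirectSum.
Variables (G : groupType) (V : zmodType) (V_ : G -> {pred V}).

(* x is a finite sum of elements of the V_ g; every V_ g will contain 0, so
   constraining f outside of s is harmless. *)
Definition is_hsum (x : V) := exists (s : seq G) (f : G -> V),
  [/\ uniq s, forall g, f g \in V_ g & x = \sum_(g <- s) f g].

Definition direct_sum := (forall x, is_hsum x) /\
  forall (s : seq G) (f : G -> V), uniq s -> (forall g, f g \in V_ g) ->
    \sum_(g <- s) f g = 0 -> forall g, g \in s -> f g = 0.

Hypothesis V_cl : forall g, GRing.zmod_closed (V_ g).

Let V0 g : 0 \in V_ g. Proof. by case: (V_cl g). Qed.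
Let VB g : {in V_ g &, forall x y, x - y \in V_ g}. Proof. by case: (V_cl g). Qed.

Let widen (s d : seq G) (f : G -> V) : uniq s -> uniq d -> {subset s <= d} ->
  \sum_(g <- s) f g = \sum_(g <- d) (if g \in s then f g else 0).
Proof.
move=> us ud sd; rewrite -big_mkcond /= -[RHS]big_filter; apply: perm_big.
apply: uniq_perm; rewrite ?filter_uniq // => g; rewrite mem_filter.
by case: (boolP (g \in s)) => // /sd ->.
Qed.

Lemma hsum0 : is_hsum 0.
Proof. by exists [::], (fun=> 0); rewrite big_nil. Qed.

Lemma hsum1 g x : x \in V_ g -> is_hsum x.
Proof.
move=> xV; exists [:: g], (fun h => if h == g then x else 0); split=> //.
- by move=> h; case: eqP => // ->.
- by rewrite big_seq1 eqxx.
Qed.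

Lemma hsumB x y : is_hsum x -> is_hsum y -> is_hsum (x - y).
Proof.
move=> [s [f [us fV ->]]] [s' [f' [us' fV' ->]]].
exists (undup (s ++ s')), (fun g => (if g \in s then f g else 0)
  - (if g \in s' then f' g else 0)); split; first exact: undup_uniq.
- by move=> g; apply: VB; case: ifP.
- rewrite sumrB -!widen ?undup_uniq // => g gs;
  by rewrite mem_undup mem_cat gs ?orbT.
Qed.

Lemma direct_sumI (Z : zmodType) (p : G -> V -> Z) :
    (forall x, is_hsum x) -> (forall g, zmod_morphism (p g)) ->
    (forall g x, x \in V_ g -> p g x = 0 -> x = 0) ->
    (forall g h x, x \in V_ g -> h != g -> p h x = 0) ->
  direct_sum.
Proof.
move=> hs pB pinj p0; split=> // s f us fV f0 g gs.
apply: (pinj g) => //; have := congr1 (p g) f0.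
rewrite (zmorph0 (pB g)) (zmorph_sum (pB g)) (bigD1_seq g) //=.
by rewrite big1 ?addr0 // => h hg; apply: (p0 h); rewrite // eq_sym.
Qed.

Section Proj.
Hypothesis ds : direct_sum.

Let sup x : seq G := projT1 (cid (ds.1 x)).
Let cmp x : G -> V := projT1 (cid (projT2 (cid (ds.1 x)))).
Let supP x : [/\ uniq (sup x), forall g, cmp x g \in V_ g
  & x = \sum_(g <- sup x) cmp x g].
Proof. exact: (projT2 (cid (projT2 (cid (ds.1 x))))). Qed.

(* The homogeneous component of degree g. *)
Definition hproj (g : G) (x : V) : V := if g \in sup x then cmp x g else 0.

Lemma hproj_eq (s : seq G) (f : G -> V) g : uniq s -> (forall g, f g \in V_ g) ->
  hproj g (\sum_(h <- s) f h) = if g \in s then f g else 0.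
Proof.
move=> us fV; set x := \sum_(h <- s) _; have [us' fV' ex] := supP x.
pose d := undup (sup x ++ s); have ud : uniq d by exact: undup_uniq.
pose k h := hproj h x - (if h \in s then f h else 0).
have kV h : k h \in V_ h by rewrite /k /hproj; apply: VB; case: ifP.
have k0 : \sum_(h <- d) k h = 0.
  rewrite sumrB -!widen ?undup_uniq -?ex ?subrr // => h hs;
  by rewrite mem_undup mem_cat hs ?orbT.
case: (boolP (g \in d)) => [/(ds.2 _ _ ud kV k0)/eqP|].
  by rewrite subr_eq0 => /eqP.
by rewrite mem_undup mem_cat negb_or /hproj => /andP[/negbTE-> /negbTE->].
Qed.

Lemma hproj_in g x : hproj g x \in V_ g.
Proof. by rewrite /hproj; case: ifP => // _; case: (supP x). Qed.

Lemma hproj_sum x : exists s : seq G, [/\ uniq s,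
  forall g, g \notin s -> hproj g x = 0 & x = \sum_(g <- s) hproj g x].
Proof.
have [us _ ex] := supP x; exists (sup x); split=> //.
  by move=> g /negbTE; rewrite /hproj => ->.
rewrite {1}ex; apply: eq_big_seq => g; by rewrite /hproj => ->.
Qed.

Lemma hproj_id g h x : x \in V_ g -> hproj h x = if h == g then x else 0.
Proof.
move=> xV; pose f k := if k == g then x else 0.
have {1}-> : x = \sum_(k <- [:: g]) f k by rewrite big_seq1 /f eqxx.
rewrite hproj_eq //; first by rewrite inE /f; case: eqP.
by move=> k; rewrite /f; case: eqP => // ->.
Qed.

Lemma hprojB g : zmod_morphism (hproj g).
Proof.
move=> x y; have [s [us s0 ex]] := hproj_sum x; have [t [ut t0 ey]] := hproj_sum y.
pose d := undup (s ++ t).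
have ew z r : uniq r -> (forall h, h \notin r -> hproj h z = 0) ->
    z = \sum_(h <- r) hproj h z -> {subset r <= d} -> z = \sum_(h <- d) hproj h z.
  move=> ur r0 ez rd; rewrite [LHS]ez (widen _ ur (undup_uniq _) rd).
  by apply: eq_bigr => h _; case: ifPn => // /r0.
have -> : x - y = \sum_(h <- d) (hproj h x - hproj h y).
  rewrite sumrB -(ew x s) -?(ew y t) // => h hs;
  by rewrite mem_undup mem_cat hs ?orbT.
rewrite hproj_eq ?undup_uniq //; last by move=> h; apply: VB; exact: hproj_in.
case: ifPn => //; rewrite mem_undup mem_cat negb_or => /andP[/s0-> /t0->].
by rewrite subrr.
Qed.
End Proj.
End DirectSum.

Section GradedAlgebra.
Variables (F : fieldType) (G : groupType).

(* Boolean predicates are no restriction here: the development is classical,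
   and any subset is one through asbool. *)
Record gradedAlg := GradedAlg {
  galg :> algType F;
  gcomp : G -> {pred galg};
  gcomp_closed : forall g, GRing.submod_closed (gcomp g);
  gcomp_sum : direct_sum gcomp;
  gcompM : forall g h, {in gcomp g & gcomp h, forall x y,
    x * y \in gcomp (g * h)%g}
}.
Arguments gcomp : clear implicits.
Arguments gcomp_closed : clear implicits.
Arguments gcomp_sum : clear implicits.

Variable A : gradedAlg.

Lemma gcomp_zmod g : GRing.zmod_closed (gcomp A g).
Proof. exact/GRing.submod_closedB/gcomp_closed. Qed.

HB.instance Definition _ g :=
  GRing.isSubmodClosed.Build F A (gcomp A g) (gcomp_closed A g).

Lemma gcomp1 : 1 \in gcomp A 1%g.
Proof.
pose p := hproj (gcomp_sum A); pose e := p 1%g 1.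
have cl := gcomp_zmod; have ds := gcomp_sum A.
have eh h a : a \in gcomp A h -> a * e = a.
  move=> aA; have [s [us s0 e1]] := hproj_sum (gcomp_sum A) 1.
  have pB := hprojB cl (gcomp_sum A).
  have ha : hproj (gcomp_sum A) h a = a by rewrite (hproj_id cl _ h aA) eqxx.
  have aE : a = \sum_(g <- s) hproj (gcomp_sum A) h (a * hproj (gcomp_sum A) g 1).
    by rewrite -(zmorph_sum (pB h)) -mulr_sumr -e1 mulr1 ha.
  rewrite [RHS]aE (eq_bigr (fun g => if g == 1%g then a * e else 0)).
    rewrite -big_mkcond /=.
    case: (boolP (1%g \in s)) => [i1|/[dup] /s0 ei n1].
      by rewrite -big_filter filter_pred1_uniq // big_seq1.
    by rewrite /e /p ei mulr0 big1.
  move=> g _; have aM : a * hproj (gcomp_sum A) g 1 \in gcomp A (h * g)%g.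
    by apply: gcompM => //; exact: hproj_in.
  rewrite (hproj_id cl (gcomp_sum A) h aM).
  rewrite -{1}[h]mulg1 (inj_eq (mulgI h)) eq_sym.
  by case: eqP => // ->.
have e_id x : x * e = x.
  have [s [us s0 ->]] := hproj_sum (gcomp_sum A) x.
  rewrite mulr_suml; apply: eq_bigr => g _; apply: eh; exact: hproj_in.
by rewrite -(e_id 1) mul1r; exact: hproj_in.
Qed.

Definition base_pred : {pred A} := gcomp A 1%g.

Lemma base_closed : GRing.subalg_closed base_pred.
Proof.
split; first exact: gcomp1.
  by case: (gcomp_closed A 1%g).
by move=> x y xA yA; have := gcompM xA yA; rewrite mulg1.
Qed.
HB.instance Definition _ := GRing.isSubalgClosed.Build F A base_pred base_closed.

(* The base algebra A_e. *)
Record base := Base { base_val :> A; base_in : base_val \in base_pred }.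
HB.instance Definition _ := [isSub for base_val].
HB.instance Definition _ := [Choice of base by <:].
HB.instance Definition _ := [SubChoice_isSubAlgebra of base by <:].

End GradedAlgebra.

Arguments gcomp {F G} A g : rename.
Arguments gcomp_closed {F G} A g : rename.
Arguments gcomp_sum {F G} A : rename.
Arguments base_pred {F G} A : rename.

Section GradedModule.
Variables (F : fieldType) (G : groupType) (A : gradedAlg F G).

(* A_g is an F-subspace of A, and F 1 lies in A_e, so the homogeneous
   components of a graded module are automatically F-subspaces. *)
Record gradedMod := GradedMod {
  gmod :> lmodType A;
  mcomp : G -> {pred gmod};
  mcomp_closed : forall g, GRing.zmod_closed (mcomp g);
  mcomp_sum : direct_sum mcomp;
  mcompZ : forall g h, {in gcomp A g & mcomp h, forall a w,
    a *: w \in mcomp (g * h)%g}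
}.
Arguments mcomp : clear implicits.
Arguments mcomp_closed : clear implicits.
Arguments mcomp_sum : clear implicits.

HB.instance Definition _ (W : gradedMod) g :=
  GRing.isZmodClosed.Build W (mcomp W g) (mcomp_closed W g).

(* Degree-preserving isomorphism. *)
Definition gmod_iso (W W' : gradedMod) : Prop := exists f : {linear W -> W'},
  bijective f /\ forall g, {in mcomp W g, forall w, f w \in mcomp W' g}.

Section Suspension.
Variables (W : gradedMod) (h : G).

Definition susp_comp (g : G) : {pred W} := mcomp W (g * h)%g.

Lemma susp_closed g : GRing.zmod_closed (susp_comp g).
Proof. exact: mcomp_closed. Qed.

Lemma susp_sum : direct_sum susp_comp.
Proof.
have [hs hi] := mcomp_sum W; split=> [x|s f us fW f0 g gs].
  have [s [f [us fW ->]]] := hs x.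
  exists [seq (g * h^-1)%g | g <- s], (fun g => f (g * h)%g); split=> //.
    by rewrite map_inj_uniq //; exact: mulIg.
  by rewrite big_map; apply: eq_bigr => g _; rewrite mulgVK.
rewrite -(mulgK h g); apply: (hi [seq (k * h)%g | k <- s]
  (fun k => f (k * h^-1)%g) _ _ _ (g * h)%g).
- by rewrite map_inj_uniq //; exact: mulIg.
- by move=> k; have := fW (k * h^-1)%g; rewrite /susp_comp unfold_in mulgVK.
- by rewrite big_map -[RHS]f0; apply: eq_bigr => k _; rewrite mulgK.
- exact: map_f.
Qed.

Lemma suspZ g k : {in gcomp A g & susp_comp k, forall a w,
  a *: w \in susp_comp (g * k)%g}.
Proof. by move=> a w aA wW; rewrite /susp_comp -mulgA; exact: mcompZ. Qed.

(* The suspension h(W): h(W)_g = W_(gh). *)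
Definition susp := GradedMod susp_closed susp_sum suspZ.
End Suspension.

Section MaxSub.
Variable W : gradedMod.

(* S is a graded submodule: a submodule with S = \sum_g (S \cap W_g). *)
Definition graded_sub (S : {pred W}) : Prop := GRing.submod_closed S /\
  {in S, forall x, is_hsum (fun g => [predI S & mcomp W g]) x}.

Definition zero_at_e (S : {pred W}) : Prop :=
  forall x, x \in S -> x \in mcomp W 1%g -> x = 0.

(* The union of all graded submodules with zero e-component. The three lemmas
   below show that it is the largest of them. *)
Definition maxsub : {pred W} := fun x =>
  `[< exists S : {pred W}, [/\ graded_sub S, zero_at_e S & x \in S] >].

Let cl := mcomp_closed W.
Let ds := mcomp_sum W.

Lemma graded_sub_proj (S : {pred W}) : graded_sub S ->
  {in S, forall x g, hproj ds g x \in S}.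
Proof.
move=> [[S0 _] hS] x /hS [s [f [us fS ->]]] g; rewrite hproj_eq //.
  by case: ifP => // _; have /andP[] := fS g.
by move=> h; have /andP[] := fS h.
Qed.

Lemma proj_graded_sub (S : {pred W}) : GRing.submod_closed S ->
  {in S, forall x g, hproj ds g x \in S} -> graded_sub S.
Proof.
move=> Scl Sp; split=> // x xS; have [s [us _ ex]] := hproj_sum ds x.
exists s, (fun g => hproj ds g x); split=> // g.
by apply/andP; split; [exact: Sp | exact: hproj_in].
Qed.

Lemma maxsubP x : reflect
  (exists S : {pred W}, [/\ graded_sub S, zero_at_e S & x \in S]) (x \in maxsub).
Proof. exact: asboolP. Qed.

Lemma maxsub_closed : GRing.submod_closed maxsub.
Proof.
split.
  apply/maxsubP; exists (fun y : W => y == 0); split; last exact: eqxx.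
    apply: proj_graded_sub => [|x /eqP-> g].
      split; first exact: eqxx.
      by move=> a u v /eqP-> /eqP->; rewrite scaler0 addr0; apply/eqP.
    by apply/eqP; exact: (zmorph0 (hprojB cl ds g)).
  by move=> x /eqP.
move=> a x y /maxsubP[S [Sg Se xS]] /maxsubP[T [Tg Te yT]].
have [[S0 SD] _] := Sg; have [[T0 TD] _] := Tg.
pose U : {pred W} := fun z => `[< exists2 u, u \in S & exists2 v, v \in T & z = u + v >].
have UP z : reflect (exists2 u, u \in S & exists2 v, v \in T & z = u + v) (z \in U).
  exact: asboolP.
apply/maxsubP; exists U; split.
- apply: proj_graded_sub => [|z /UP[u uS [v vT ->]] g].
    split; first by apply/UP; exists 0 => //; exists 0; rewrite ?addr0.
    move=> b z z' /UP[u uS [v vT ->]] /UP[u' uS' [v' vT' ->]].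
    apply/UP; exists (b *: u + u'); first exact: SD.
    by exists (b *: v + v'); [exact: TD | rewrite scalerDr addrACA].
  apply/UP; exists (hproj ds g u); first exact: graded_sub_proj.
  exists (hproj ds g v); first exact: graded_sub_proj.
  by rewrite (zmorphD (hprojB cl ds g)).
- move=> z /UP[u uS [v vT ->]] /(hproj_id cl ds 1%g); rewrite eqxx => <-.
  rewrite (zmorphD (hprojB cl ds _)).
  have -> : hproj ds 1%g u = 0.
    by apply: Se; [exact: (graded_sub_proj Sg) | exact: (hproj_in cl ds)].
  have -> : hproj ds 1%g v = 0.
    by apply: Te; [exact: (graded_sub_proj Tg) | exact: (hproj_in cl ds)].
  by rewrite addr0.
- apply/UP; exists (a *: x); first by rewrite -[_ *: _]addr0; exact: SD.
  by exists y.
Qed.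

Lemma maxsub_graded : graded_sub maxsub.
Proof.
apply: proj_graded_sub; first exact: maxsub_closed.
move=> x /maxsubP[S [Sg Se xS]] g; apply/maxsubP; exists S; split=> //.
exact: graded_sub_proj.
Qed.

Lemma maxsub_e : zero_at_e maxsub.
Proof. by move=> x /maxsubP[S [_ Se xS]]; exact: Se. Qed.

Lemma maxsub_max (S : {pred W}) : graded_sub S -> zero_at_e S ->
  {subset S <= maxsub}.
Proof. by move=> Sg Se x xS; apply/maxsubP; exists S. Qed.

HB.instance Definition _ := GRing.isSubmodClosed.Build A W maxsub maxsub_closed.

Definition redtype := Quotient.quot maxsub.
HB.instance Definition _ := GRing.Zmodule.on redtype.

Local Notation pi := (\pi_(Quotient.quot maxsub)%qT).

Definition red_scale (a : A) (q : redtype) : redtype := pi (a *: repr q).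

Let pi_eq x y : x - y \in maxsub -> pi x = pi y :> redtype.
Proof. by rewrite Quotient.idealrBE => /eqP. Qed.

Let eq_pi x y : pi x = pi y :> redtype -> x - y \in maxsub.
Proof. by move=> e; rewrite Quotient.idealrBE; apply/eqP. Qed.

Lemma red_scaleE a x : red_scale a (pi x) = pi (a *: x).
Proof. by apply: pi_eq; rewrite -scalerBr rpredZ // eq_pi // reprK. Qed.

Lemma red_scaleA a b q : red_scale a (red_scale b q) = red_scale (a * b) q.
Proof.
rewrite -[q]reprK (red_scaleE b) !(red_scaleE _ (_ *: _)) red_scaleE.
by rewrite scalerA.
Qed.
Lemma red_scale1 : left_id 1 red_scale.
Proof. by move=> q; rewrite -[q]reprK red_scaleE scale1r. Qed.
Lemma red_scaleDr : right_distributive red_scale +%R.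
Proof.
move=> a q r; rewrite -[q]reprK -[r]reprK -raddfD !red_scaleE -raddfD.
by rewrite scalerDr.
Qed.
Lemma red_scaleDl q : {morph red_scale^~ q : a b / a + b}.
Proof. by move=> a b; rewrite -[q]reprK !red_scaleE -raddfD scalerDl. Qed.

HB.instance Definition _ := GRing.Zmodule_isLmodule.Build A redtype
  red_scaleA red_scale1 red_scaleDr red_scaleDl.

Definition red_comp (g : G) : {pred redtype} := fun q =>
  `[< exists2 x, x \in mcomp W g & q = pi x >].

Lemma red_compP g q :
  reflect (exists2 x, x \in mcomp W g & q = pi x) (q \in red_comp g).
Proof. exact: asboolP. Qed.

Lemma red_closed g : GRing.zmod_closed (red_comp g).
Proof.
split; first by apply/red_compP; exists 0; rewrite ?rpred0 // raddf0.
move=> p q /red_compP[x xW ->] /red_compP[y yW ->]; apply/red_compP.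
by exists (x - y); rewrite ?rpredB // raddfB.
Qed.

Lemma red_sum : direct_sum red_comp.
Proof.
split=> [q|s f us fW f0 g gs].
  rewrite -[q]reprK; have [s [us _ ->]] := hproj_sum ds (repr q).
  exists s, (fun g => pi (hproj ds g (repr q))); split=> //.
    by move=> g; apply/red_compP; exists (hproj ds g (repr q)); rewrite ?hproj_in.
  by rewrite raddf_sum.
have ex h : {x | x \in mcomp W h & f h = pi x}.
  by apply: cid2; apply/red_compP.
pose x h := s2val (ex h).
have xW h : x h \in mcomp W h by exact: (s2valP (ex h)).
have fx h : f h = pi (x h) by exact: (s2valP' (ex h)).
have sT : \sum_(h <- s) x h \in maxsub.
  rewrite -[X in X \in _]subr0; apply: eq_pi; rewrite raddf_sum raddf0 -[RHS]f0.
  by apply: eq_bigr => h _; rewrite fx.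
have := graded_sub_proj maxsub_graded sT g.
rewrite hproj_eq // gs fx => xT; rewrite -[RHS](raddf0 pi).
by apply: pi_eq; rewrite subr0.
Qed.

Lemma redZ g h : {in gcomp A g & red_comp h, forall a w,
  a *: w \in red_comp (g * h)%g}.
Proof.
move=> a q aA /red_compP[x xW ->]; apply/red_compP; exists (a *: x).
  exact: mcompZ.
exact: red_scaleE.
Qed.

(* The graded quotient of W by maxsub. *)
Definition red := GradedMod red_closed red_sum redZ.
End MaxSub.

Section Induction.
Variable M : lmodType (base A).

(* A (x)_(A_e) M. *)
Definition indtype := tensor (fun (a : A) (x : base A) => a * base_val x)
  (fun (x : base A) (m : M) => x *: m).
HB.instance Definition _ := GRing.Zmodule.on indtype.

Definition itens (a : A) (m : M) : indtype := tens _ _ a m.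
Local Notation "a # m" := (itens a m) (at level 40).

(* b (a (x) m) = (b a) (x) m *)
Definition ind_scale (b : A) : indtype -> indtype :=
  tlift (fun a m => (b * a) # m).

Let ibal b : balanced (fun (a : A) (x : base A) => a * base_val x)
  (fun (x : base A) (m : M) => x *: m) (fun a m => (b * a) # m).
Proof.
split=> [m a a'|a m m'|a x m]; first by rewrite mulrBr /itens tensBl.
  by rewrite /itens tensBr.
by rewrite mulrA /itens tens_bal.
Qed.

Lemma ind_scaleE b a m : ind_scale b (a # m) = (b * a) # m.
Proof. exact: (tliftE (ibal b)). Qed.

Lemma ind_scaleB b : zmod_morphism (ind_scale b).
Proof. exact: (tliftB (ibal b)). Qed.

Lemma ind_scaleA b c t : ind_scale b (ind_scale c t) = ind_scale (b * c) t.
Proof.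
apply: (tens_ext (f := fun t => ind_scale b (ind_scale c t))) t.
- by move=> x y; rewrite !ind_scaleB.
- exact: ind_scaleB.
- by move=> a m; rewrite -/(a # m) !ind_scaleE mulrA.
Qed.
Lemma ind_scale1 : left_id 1 ind_scale.
Proof.
apply: (tens_ext (g := id)) => //; first exact: ind_scaleB.
by move=> a m; rewrite -/(a # m) ind_scaleE mul1r.
Qed.
Lemma ind_scaleDr : right_distributive ind_scale +%R.
Proof. by move=> b x y; exact: zmorphD (ind_scaleB b) _ _. Qed.
Lemma ind_scaleDl t : {morph ind_scale^~ t : a b / a + b}.
Proof.
move=> b c; apply: (tens_ext (g := fun t => ind_scale b t + ind_scale c t)) t.
- exact: ind_scaleB.
- by move=> x y; rewrite !ind_scaleB opprD addrACA.
- by move=> a m; rewrite -/(a # m) !ind_scaleE mulrDl /itens tensDl.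
Qed.

HB.instance Definition _ := GRing.Zmodule_isLmodule.Build A indtype
  ind_scaleA ind_scale1 ind_scaleDr ind_scaleDl.

(* (A (x) M)_g = A_g (x) M, as the subgroup generated by the a (x) m, a in A_g. *)
Definition ind_comp (g : G) : {pred indtype} :=
  zspan [set t | exists2 a, a \in gcomp A g & exists m, t = a # m].

Lemma ind_closed g : GRing.zmod_closed (ind_comp g).
Proof. exact: zspan_closed. Qed.

Let cl := gcomp_zmod A.
Let ds := gcomp_sum A.

Let pg (g : G) (t : indtype) : indtype := tlift (fun a m => hproj ds g a # m) t.

Let hproj_base g a (x : base A) :
  hproj ds g (a * base_val x) = hproj ds g a * base_val x.
Proof.
have [s [us s0 ea]] := hproj_sum ds a.
rewrite [in LHS]ea mulr_suml hproj_eq //.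
  by case: ifPn => // /s0 ->; rewrite mul0r.
move=> h; have := gcompM (hproj_in cl ds h a) (base_in x).
by rewrite mulg1.
Qed.

Let pbal g : balanced (fun (a : A) (x : base A) => a * base_val x)
  (fun (x : base A) (m : M) => x *: m) (fun a m => hproj ds g a # m).
Proof.
split=> [m a a'|a m m'|a x m]; first by rewrite (hprojB cl) /itens tensBl.
  by rewrite /itens tensBr.
by rewrite hproj_base /itens tens_bal.
Qed.

Lemma ind_sum : direct_sum ind_comp.
Proof.
have cl' := ind_closed.
have pE g a m : pg g (a # m) = hproj ds g a # m by exact: (tliftE (pbal g)).
have pB g : zmod_morphism (pg g) by exact: tliftB (pbal g).
apply: (@direct_sumI _ _ _ _ pg) => // [t|g t tg|g h t tg hg].
- move: t; apply: tens_ind => [|x y|a m]; [exact: hsum0 | exact: hsumB |].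
  have [s [us _ ea]] := hproj_sum ds a.
  exists s, (fun g => hproj ds g a # m); split=> //.
    by move=> g; apply: zspan_gen; exists (hproj ds g a); [exact: hproj_in | exists m].
  rewrite {1}ea; apply: (zmorph_sum (h := fun a => itens a m)) => b c.
  exact: tensBl.
- have -> // : pg g t = t.
  move: t tg; apply: zspan_ind => [|x y ex ey|t [a aA [m ->]]].
  + exact: zmorph0.
  + by rewrite pB ex ey.
  + by rewrite pE (hproj_id cl ds g aA) eqxx.
- move: t tg; apply: zspan_ind => [|x y ex ey|t [a aA [m ->]]].
  + exact: zmorph0.
  + by rewrite pB ex ey subr0.
  + by rewrite pE (hproj_id cl ds h aA) (negbTE hg) /itens tens0l.
Qed.

Lemma indZ g h : {in gcomp A g & ind_comp h, forall a w,
  a *: w \in ind_comp (g * h)%g}.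
Proof.
move=> b t bA; move: t; apply: zspan_ind => [|x y xI yI|t [a aA [m ->]]].
- by rewrite scaler0; case: (ind_closed (g * h)%g).
- by rewrite scalerBr; case: (ind_closed (g * h)%g) => _; apply.
- apply: zspan_gen; exists (b * a); first exact: gcompM.
  by exists m; exact: ind_scaleE.
Qed.

Definition gtens := GradedMod ind_closed ind_sum indZ.

(* A \overline{\otimes}_{A_e} M *)
Definition gtens_red : gradedMod := red gtens.

(* The inertia of M. *)
Definition inertia : set G := [set g | gmod_iso gtens_red (susp gtens_red g)].

Definition G_invariant : Prop := inertia = setT.
End Induction.
End GradedModule.

(* Z^2(G, F^* ) for the trivial action; cocycles need not be normalized. *)
Record cocycle2 (F : fieldType) (G : groupType) := Cocycle2 {
  cocycle2_fun :> G -> G -> F;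
  cocycle2_neq0 : forall g h, cocycle2_fun g h != 0;
  cocycle2P : forall g h k, cocycle2_fun g h * cocycle2_fun (g * h)%g k
    = cocycle2_fun g (h * k)%g * cocycle2_fun h k
}.

(* F^alpha G; its multiplication, given below, depends on alpha. *)
Definition twgrp (F : fieldType) (G : groupType) (alpha : cocycle2 F G) : Type :=
  {malg F[G]}.

Section TwistedGroupAlgebra.
Variables (F : fieldType) (G : groupType) (alpha : cocycle2 F G).

Lemma cocycle1g g : alpha 1%g g = alpha 1%g 1%g.
Proof.
have := cocycle2P alpha 1%g 1%g g; rewrite !mul1g.
by move=> /(mulIf (cocycle2_neq0 alpha _ _)) ->.
Qed.
Lemma cocycleg1 g : alpha g 1%g = alpha 1%g 1%g.
Proof.
have := cocycle2P alpha g 1%g 1%g; rewrite !mulg1.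
by move=> /(mulfI (cocycle2_neq0 alpha _ _)) ->.
Qed.

Local Notation T := (twgrp alpha).

HB.instance Definition _ := GRing.Lmodule.on T.

Definition vbasis (g : G) : T := << g >>.

Definition twgrp_one : T := << (alpha 1%g 1%g)^-1 *g 1%g >>.

(* v_g v_h = alpha(g, h) v_(gh), extended bilinearly *)
Definition twgrp_mul (x y : T) : T :=
  mlift (fun g c => mlift (fun h d => << c * d * alpha g h *g (g * h)%g >>) y) x.

Let inB (g : G) c h : zmod_morphism
  (fun d => << c * d * alpha g h *g (g * h)%g >> : T).
Proof. by move=> d d'; rewrite mulrBr mulrBl monalgUB. Qed.

Let outB g (y : T) : zmod_morphism
  (fun c => mlift (fun h d => << c * d * alpha g h *g (g * h)%g >> : T) y).
Proof.
move=> c c'; rewrite /mlift -sumrB; apply: eq_bigr => h _.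
by rewrite !mulrBl monalgUB.
Qed.

Lemma twgrp_mulBl y : zmod_morphism (twgrp_mul^~ y).
Proof. by apply: mliftB => g; exact: outB. Qed.

Lemma twgrp_mulBr x : zmod_morphism (twgrp_mul x).
Proof.
move=> y y'; rewrite /twgrp_mul /mlift -sumrB; apply: eq_bigr => g _.
exact: (mliftB (inB g _)).
Qed.

Lemma twgrp_mulU c g d h : twgrp_mul << c *g g >> << d *g h >> =
  << c * d * alpha g h *g (g * h)%g >>.
Proof.
rewrite /twgrp_mul mliftU => [|k]; last exact: outB.
by rewrite mliftU => // k; exact: inB.
Qed.

Lemma twgrp_mulA : associative twgrp_mul.
Proof.
move=> x y z; apply: (malg_ext (f := fun x => twgrp_mul x (twgrp_mul y z))
  (g := fun x => twgrp_mul (twgrp_mul x y) z)) x => [||g c].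
- exact: twgrp_mulBl.
- by move=> x x'; rewrite !twgrp_mulBl.
apply: (malg_ext (f := fun y => twgrp_mul _ (twgrp_mul y z))
  (g := fun y => twgrp_mul (twgrp_mul _ y) z)) y => [||h d].
- by move=> y y'; rewrite twgrp_mulBl twgrp_mulBr.
- by move=> y y'; rewrite twgrp_mulBr twgrp_mulBl.
apply: (malg_ext (f := fun z => twgrp_mul _ (twgrp_mul _ z))
  (g := fun z => twgrp_mul (twgrp_mul _ _) z)) z => [||k e].
- by move=> z z'; rewrite !twgrp_mulBr.
- exact: twgrp_mulBr.
rewrite !twgrp_mulU mulgA; congr << _ *g _ >>.
have -> : c * (d * e * alpha h k) * alpha g (h * k)%g =
    c * d * e * (alpha g (h * k)%g * alpha h k).
  by rewrite -!mulrA [alpha h k * _]mulrC.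
by rewrite -cocycle2P -!mulrA; do 2 congr (_ * _); rewrite mulrCA.
Qed.

Lemma twgrp_mul1 : left_id twgrp_one twgrp_mul.
Proof.
apply: (malg_ext (g := id)) => // [|g c]; first exact: twgrp_mulBr.
rewrite twgrp_mulU mul1g cocycle1g mulrAC mulVf ?mul1r //.
exact: cocycle2_neq0.
Qed.

Lemma twgrp_mulr1 : right_id twgrp_one twgrp_mul.
Proof.
apply: (malg_ext (f := twgrp_mul^~ _) (g := id)) => // [|g c].
  exact: twgrp_mulBl.
rewrite twgrp_mulU mulg1 cocycleg1 -mulrA mulVf ?mulr1 //.
exact: cocycle2_neq0.
Qed.

Lemma twgrp_mulDl : left_distributive twgrp_mul +%R.
Proof. by move=> x y z; exact: (zmorphD (twgrp_mulBl z)). Qed.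
Lemma twgrp_mulDr : right_distributive twgrp_mul +%R.
Proof. by move=> x y z; exact: (zmorphD (twgrp_mulBr x)). Qed.

Lemma twgrp_one_neq0 : twgrp_one != 0.
Proof. by rewrite monalgU_eq0 invr_eq0 cocycle2_neq0. Qed.

HB.instance Definition _ := GRing.Zmodule_isNzRing.Build T twgrp_mulA
  twgrp_mul1 twgrp_mulr1 twgrp_mulDl twgrp_mulDr twgrp_one_neq0.

Lemma twgrp_scaleU (a c : F) g : a *: (<< c *g g >> : T) = << a * c *g g >>.
Proof. by apply/malgP => k; rewrite mcoeffZ !mcoeffU mulrnAr. Qed.

Lemma twgrp_scalerAl (a : F) (x y : T) : a *: (x * y) = (a *: x) * y.
Proof.
apply: (malg_ext (f := fun x => a *: twgrp_mul x y)
  (g := fun x => twgrp_mul (a *: x) y)) x => [||g c].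
- by move=> x x'; rewrite twgrp_mulBl scalerBr.
- by move=> x x'; rewrite scalerBr twgrp_mulBl.
apply: (malg_ext (f := fun y => a *: twgrp_mul _ y)) y => [||h d].
- by move=> y y'; rewrite twgrp_mulBr scalerBr.
- exact: twgrp_mulBr.
by rewrite twgrp_scaleU !twgrp_mulU twgrp_scaleU !mulrA.
Qed.

HB.instance Definition _ := GRing.Lmodule_isLalgebra.Build F T twgrp_scalerAl.

Lemma twgrp_scalerAr (a : F) (x y : T) : a *: (x * y) = x * (a *: y).
Proof.
apply: (malg_ext (f := fun x => a *: twgrp_mul x y)
  (g := fun x => twgrp_mul x (a *: y))) x => [||g c].
- by move=> x x'; rewrite twgrp_mulBl scalerBr.
- exact: twgrp_mulBl.
apply: (malg_ext (f := fun y => a *: twgrp_mul _ y)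
  (g := fun y => twgrp_mul _ (a *: y))) y => [||h d].
- by move=> y y'; rewrite twgrp_mulBr scalerBr.
- by move=> y y'; rewrite scalerBr twgrp_mulBr.
rewrite twgrp_scaleU !twgrp_mulU twgrp_scaleU; congr << _ *g _ >>.
by rewrite !mulrA [a * c]mulrC.
Qed.

HB.instance Definition _ := GRing.Lalgebra_isAlgebra.Build F T twgrp_scalerAr.

Lemma vbasisM g h : vbasis g * vbasis h = alpha g h *: vbasis (g * h)%g.
Proof. by rewrite [LHS]twgrp_mulU !mul1r twgrp_scaleU mulr1. Qed.

Lemma twgrp1E : 1 = (alpha 1%g 1%g)^-1 *: vbasis 1%g.
Proof. by rewrite twgrp_scaleU mulr1. Qed.

End TwistedGroupAlgebra.
Arguments vbasis {F G} alpha g.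

Section TwistedTensor.
Variables (F : fieldType) (G : groupType) (alpha : cocycle2 F G).

Section Algebra.
Variable A : algType F.

(* F^alpha G (x)_F A *)
Definition twtens := tensor (fun (u : twgrp alpha) (c : F) => c *: u)
  (fun (c : F) (a : A) => c *: a).
HB.instance Definition _ := GRing.Zmodule.on twtens.

Definition ttens (u : twgrp alpha) (a : A) : twtens := tens _ _ u a.
Local Notation "u # a" := (ttens u a) (at level 40).

Let bal (Z : zmodType) := @balanced F _ _
  (fun (u : twgrp alpha) (c : F) => c *: u) (fun (c : F) (a : A) => c *: a) Z.

Lemma ttens_bal c u a : (c *: u) # a = u # (c *: a).
Proof. exact: tens_bal. Qed.

(* v (x) b |-> (u v) (x) (a b) *)
Definition ttens_mull (u : twgrp alpha) (a : A) : twtens -> twtens :=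
  tlift (fun v b => (u * v) # (a * b)).

(* (u (x) a) (v (x) b) = (u v) (x) (a b) *)
Definition ttens_mul (s t : twtens) : twtens :=
  tlift (fun u a => ttens_mull u a t) s.

Let inbal u a : bal (fun v b => (u * v) # (a * b)).
Proof.
split=> [x y z|x y z|x c z].
- by rewrite mulrBr /ttens tensBl.
- by rewrite mulrBr /ttens tensBr.
- by rewrite -scalerAr -scalerAr ttens_bal.
Qed.

Lemma ttens_mullB u a : zmod_morphism (ttens_mull u a).
Proof. exact: (tliftB (inbal u a)). Qed.

Lemma ttens_mullE u a v b : ttens_mull u a (v # b) = (u * v) # (a * b).
Proof. exact: (tliftE (inbal u a)). Qed.

Let outbal t : bal (fun u a => ttens_mull u a t).
Proof.
split=> [a u u'|u a a'|u c a].
- apply: (tens_ext (g := fun t => ttens_mull u a t - ttens_mull u' a t)) t.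
  + exact: ttens_mullB.
  + exact: zmorph_sub (ttens_mullB _ _) (ttens_mullB _ _).
  + by move=> v b; rewrite -/(v # b) !ttens_mullE mulrBl /ttens tensBl.
- apply: (tens_ext (g := fun t => ttens_mull u a t - ttens_mull u a' t)) t.
  + exact: ttens_mullB.
  + exact: zmorph_sub (ttens_mullB _ _) (ttens_mullB _ _).
  + by move=> v b; rewrite -/(v # b) !ttens_mullE mulrBl /ttens tensBr.
- apply: (tens_ext _ _ _ t) => [||v b]; try exact: ttens_mullB.
  by rewrite -/(v # b) !ttens_mullE -!scalerAl ttens_bal.
Qed.

Lemma ttens_mulBl t : zmod_morphism (ttens_mul^~ t).
Proof. exact: (tliftB (outbal t)). Qed.

Lemma ttens_mulBr s : zmod_morphism (ttens_mul s).
Proof.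
move=> t t'; apply: (tens_ext (f := fun s => ttens_mul s (t - t'))
  (g := fun s => ttens_mul s t - ttens_mul s t')) s; first exact: ttens_mulBl.
  exact: zmorph_sub (ttens_mulBl _) (ttens_mulBl _).
by move=> u a; rewrite /ttens_mul !(tliftE (outbal _)) ttens_mullB.
Qed.

Lemma ttens_mulE u a v b : ttens_mul (u # a) (v # b) = (u * v) # (a * b).
Proof. by rewrite /ttens_mul (tliftE (outbal _)) ttens_mullE. Qed.

Lemma ttens_mulA : associative ttens_mul.
Proof.
move=> x y z; apply: (tens_ext (f := fun x => ttens_mul x (ttens_mul y z))
  (g := fun x => ttens_mul (ttens_mul x y) z)) x => [||u a].
- exact: ttens_mulBl.
- exact: (zmorph_comp (ttens_mulBl z) (ttens_mulBl y)).
apply: (tens_ext (f := fun y => ttens_mul _ (ttens_mul y z))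
  (g := fun y => ttens_mul (ttens_mul _ y) z)) y => [||v b].
- exact: (zmorph_comp (ttens_mulBr _) (ttens_mulBl z)).
- exact: (zmorph_comp (ttens_mulBl z) (ttens_mulBr _)).
apply: (tens_ext (f := fun z => ttens_mul _ (ttens_mul _ z))
  (g := fun z => ttens_mul (ttens_mul _ _) z)) z => [||w c].
- exact: (zmorph_comp (ttens_mulBr _) (ttens_mulBr _)).
- exact: ttens_mulBr.
by rewrite -/(u # a) -/(v # b) -/(w # c) !ttens_mulE !mulrA.
Qed.

Lemma ttens_mul1 : left_id (1 # 1) ttens_mul.
Proof.
apply: (tens_ext (g := id)) => // [|u a]; first exact: ttens_mulBr.
by rewrite -/(u # a) ttens_mulE !mul1r.
Qed.
Lemma ttens_mulr1 : right_id (1 # 1) ttens_mul.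
Proof.
apply: (tens_ext (f := ttens_mul^~ _) (g := id)) => // [|u a].
  exact: ttens_mulBl.
by rewrite -/(u # a) ttens_mulE !mulr1.
Qed.
Lemma ttens_mulDl : left_distributive ttens_mul +%R.
Proof. by move=> x y z; exact: (zmorphD (ttens_mulBl z)). Qed.
Lemma ttens_mulDr : right_distributive ttens_mul +%R.
Proof. by move=> x y z; exact: (zmorphD (ttens_mulBr x)). Qed.

(* The A-valued coefficient of v_g. *)
Definition tcoef (g : G) : twtens -> A := tlift (fun u a => mcoeff g u *: a).

Let coefbal g : bal (fun u a => mcoeff g u *: a).
Proof.
split=> [a u v|u a b|u c a].
- by rewrite mcoeffB scalerBl.
- by rewrite scalerBr.
- by rewrite mcoeffZ scalerA mulrC.
Qed.

Lemma tcoefB g : zmod_morphism (tcoef g).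
Proof. exact: (tliftB (coefbal g)). Qed.

Lemma tcoefE g u a : tcoef g (u # a) = mcoeff g u *: a.
Proof. exact: (tliftE (coefbal g)). Qed.

Lemma tcoef_basis g h a : tcoef h (vbasis alpha g # a) = if g == h then a else 0.
Proof.
by rewrite tcoefE mcoeffU; case: eqP; rewrite ?mulr1n ?scale1r ?mulr0n ?scale0r.
Qed.

Lemma ttens1_neq0 : 1 # 1 != 0.
Proof.
apply/eqP => /(congr1 (tcoef 1%g)).
rewrite (zmorph0 (tcoefB _)) twgrp1E ttens_bal tcoef_basis eqxx => /eqP.
by rewrite scaler_eq0 invr_eq0 (negbTE (cocycle2_neq0 _ _ _)) oner_eq0.
Qed.

HB.instance Definition _ := GRing.Zmodule_isNzRing.Build twtens ttens_mulA
  ttens_mul1 ttens_mulr1 ttens_mulDl ttens_mulDr ttens1_neq0.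

Definition ttens_scale (c : F) : twtens -> twtens := tlift (fun u a => (c *: u) # a).

Let scbal c : bal (fun u a => (c *: u) # a).
Proof.
split=> [a u v|u a b|u d a].
- by rewrite scalerBr /ttens tensBl.
- by rewrite /ttens tensBr.
- by rewrite scalerA mulrC -scalerA ttens_bal.
Qed.

Lemma ttens_scaleB c : zmod_morphism (ttens_scale c).
Proof. exact: (tliftB (scbal c)). Qed.
Lemma ttens_scaleE c u a : ttens_scale c (u # a) = (c *: u) # a.
Proof. exact: (tliftE (scbal c)). Qed.

Lemma ttens_scaleA c d t : ttens_scale c (ttens_scale d t) = ttens_scale (c * d) t.
Proof.
apply: (tens_ext (f := fun t => ttens_scale c (ttens_scale d t))) t => [||u a].
- exact: (zmorph_comp (ttens_scaleB c) (ttens_scaleB d)).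
- exact: ttens_scaleB.
- by rewrite -/(u # a) !ttens_scaleE scalerA.
Qed.
Lemma ttens_scale1 : left_id 1 ttens_scale.
Proof.
apply: (tens_ext (g := id)) => // [|u a]; first exact: ttens_scaleB.
by rewrite -/(u # a) ttens_scaleE scale1r.
Qed.
Lemma ttens_scaleDr : right_distributive ttens_scale +%R.
Proof. by move=> c x y; exact: (zmorphD (ttens_scaleB c)). Qed.
Lemma ttens_scaleDl t : {morph ttens_scale^~ t : c d / c + d}.
Proof.
move=> c d; apply: (tens_ext (g := fun t => ttens_scale c t + ttens_scale d t)) t.
- exact: ttens_scaleB.
- exact: (zmorph_add (ttens_scaleB c) (ttens_scaleB d)).
- by move=> u a; rewrite -/(u # a) !ttens_scaleE scalerDl /ttens tensDl.
Qed.

HB.instance Definition _ := GRing.Zmodule_isLmodule.Build F twtens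
  ttens_scaleA ttens_scale1 ttens_scaleDr ttens_scaleDl.

Lemma ttens_scalerAl (c : F) (x y : twtens) : c *: (x * y) = (c *: x) * y.
Proof.
apply: (tens_ext (f := fun x => ttens_scale c (ttens_mul x y))
  (g := fun x => ttens_mul (ttens_scale c x) y)) x => [||u a].
- exact: (zmorph_comp (ttens_scaleB c) (ttens_mulBl y)).
- exact: (zmorph_comp (ttens_mulBl y) (ttens_scaleB c)).
apply: (tens_ext (f := fun y => ttens_scale c (ttens_mul _ y))) y => [||v b].
- exact: (zmorph_comp (ttens_scaleB c) (ttens_mulBr _)).
- exact: ttens_mulBr.
by rewrite -/(u # a) -/(v # b) ttens_scaleE !ttens_mulE ttens_scaleE scalerAl.
Qed.

HB.instance Definition _ := GRing.Lmodule_isLalgebra.Build F twtens ttens_scalerAl.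

Lemma ttens_scalerAr (c : F) (x y : twtens) : c *: (x * y) = x * (c *: y).
Proof.
apply: (tens_ext (f := fun x => ttens_scale c (ttens_mul x y))
  (g := fun x => ttens_mul x (ttens_scale c y))) x => [||u a].
- exact: (zmorph_comp (ttens_scaleB c) (ttens_mulBl y)).
- exact: ttens_mulBl.
apply: (tens_ext (f := fun y => ttens_scale c (ttens_mul _ y))
  (g := fun y => ttens_mul _ (ttens_scale c y))) y => [||v b].
- exact: (zmorph_comp (ttens_scaleB c) (ttens_mulBr _)).
- exact: (zmorph_comp (ttens_mulBr _) (ttens_scaleB c)).
by rewrite -/(u # a) -/(v # b) ttens_scaleE !ttens_mulE ttens_scaleE scalerAr.
Qed.

HB.instance Definition _ := GRing.Lalgebra_isAlgebra.Build F twtens ttens_scalerAr.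

Lemma ttensM u a v b : (u # a) * (v # b) = (u * v) # (a * b).
Proof. exact: ttens_mulE. Qed.
Lemma ttensZ c u a : c *: (u # a) = (c *: u) # a.
Proof. exact: ttens_scaleE. Qed.

End Algebra.

Local Notation "u # a" := (ttens u a) (at level 40).

Variable A : gradedAlg F G.

(* F v_g (x) A_g inside F^alpha G (x) A *)
Definition thomog (g : G) : {pred twtens A} :=
  zspan [set x | exists c, exists2 a, a \in gcomp A g &
                   x = (c *: vbasis alpha g) # a].

(* \bigoplus_g F v_g (x) A_g inside F^alpha G (x) A *)
Definition twpred : {pred twtens A} :=
  zspan [set x | exists g, x \in thomog g].

Lemma thomogP g x : reflect (exists2 a, a \in gcomp A g & x = vbasis alpha g # a)
  (x \in thomog g).
Proof.
apply: (iffP idP) => [|[a aA ->]]; last first.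
  by apply: zspan_gen; exists 1, a; rewrite ?scale1r.
move: x; apply: zspan_ind => [|x y [a aA ->] [b bA ->]|x [c [a aA ->]]].
- by exists 0; rewrite ?rpred0 // /ttens tens0r.
- by exists (a - b); rewrite ?rpredB // /ttens tensBr.
- by exists (c *: a); rewrite ?rpredZ // ttens_bal.
Qed.

Lemma thomog_tw g x : x \in thomog g -> x \in twpred.
Proof. by move=> xg; apply: zspan_gen; exists g. Qed.

Lemma thomogM g h : {in thomog g & thomog h, forall x y, x * y \in thomog (g * h)%g}.
Proof.
move=> x y /thomogP[a aA ->] /thomogP[b bA ->].
rewrite ttensM vbasisM ttens_bal; apply/thomogP.
by exists (alpha g h *: (a * b)); rewrite ?rpredZ ?gcompM.
Qed.

Lemma thomogZ g c : {in thomog g, forall x, c *: x \in thomog g}.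
Proof.
move=> x /thomogP[a aA ->]; rewrite ttensZ ttens_bal; apply/thomogP.
by exists (c *: a); rewrite ?rpredZ.
Qed.

Lemma thomog1 a : a \in base_pred A -> 1 # a \in thomog 1%g.
Proof.
move=> aA; rewrite twgrp1E ttens_bal; apply/thomogP.
by exists ((alpha 1%g 1%g)^-1 *: a); rewrite ?rpredZ.
Qed.

Lemma twpred_closed : GRing.subalg_closed twpred.
Proof.
have twB := (zspan_closed [set x | exists g, x \in thomog g]).2.
have tw0 := (zspan_closed [set x | exists g, x \in thomog g]).1.
split.
- apply: (@thomog_tw 1%g); apply: thomog1; exact: gcomp1.
- move=> c x y xT yT; rewrite -[y]opprK; apply: (twB).
    move: x xT; apply: zspan_ind => [|x x' xT xT'|x [g xg]].
    + by rewrite scaler0.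
    + by rewrite scalerBr; exact: twB.
    + by apply: (@thomog_tw g); exact: thomogZ.
  by rewrite -sub0r; apply: twB.
- move=> x y xT yT; move: x xT; apply: zspan_ind => [|x x' xT xT'|x [g xg]].
  + by rewrite mul0r.
  + by rewrite mulrBl; exact: twB.
  move: y yT; apply: zspan_ind => [|y y' yT yT'|y [h yh]].
  + by rewrite mulr0.
  + by rewrite mulrBr; exact: twB.
  + by apply: (@thomog_tw (g * h)%g); exact: thomogM.
Qed.

HB.instance Definition _ :=
  GRing.isSubalgClosed.Build F (twtens A) twpred twpred_closed.

Record twalg := TwAlg { tw_val :> twtens A; tw_in : tw_val \in twpred }.
HB.instance Definition _ := [isSub for tw_val].
HB.instance Definition _ := [Choice of twalg by <:].
HB.instance Definition _ := [SubChoice_isSubAlgebra of twalg by <:].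

Definition twcomp (g : G) : {pred twalg} := fun x => val x \in thomog g.

Lemma twcomp_closed g : GRing.submod_closed (twcomp g).
Proof.
split; first by rewrite unfold_in raddf0 rpred0.
move=> c x y xg yg; rewrite unfold_in.
have -> : val (c *: x + y) = c *: val x + val y by [].
by rewrite rpredD // thomogZ.
Qed.

Lemma twcomp_sum : direct_sum twcomp.
Proof.
apply: (@direct_sumI _ _ _ _ (fun g x => tcoef g (val x))).
- move=> x; have : is_hsum thomog (val x).
    have cl g : GRing.zmod_closed (thomog g) by exact: zspan_closed.
    move: (val x) (valP x); apply: zspan_ind => [|y z yh zh|y [g yg]].
    + exact: hsum0.
    + exact: (hsumB cl).
    + exact: (hsum1 cl yg).
  move=> [s [f [us fT ex]]].
  exists s, (fun g => TwAlg (thomog_tw (fT g))); split=> //.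
  by apply: val_inj; rewrite ex raddf_sum.
- by move=> g x y; rewrite raddfB tcoefB.
- move=> g x /thomogP[a aA ex] /=; rewrite ex tcoef_basis eqxx => a0.
  by apply: val_inj; rewrite ex a0 raddf0 /ttens tens0r.
- move=> g h x /thomogP[a aA ->] hg.
  by rewrite tcoef_basis eq_sym (negbTE hg).
Qed.

Lemma twcompM g h : {in twcomp g & twcomp h, forall x y, x * y \in twcomp (g * h)%g}.
Proof. by move=> x y xg yh; rewrite unfold_in rmorphM thomogM. Qed.

(* The twisted graded algebra alpha(A). *)
Definition twist : gradedAlg F G := GradedAlg twcomp_closed twcomp_sum twcompM.

Lemma base_tw_in (x : base A) : 1 # base_val x \in twpred.
Proof. by apply: (@thomog_tw 1%g); apply: thomog1; exact: base_in. Qed.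

Lemma base_tw_in1 (x : base A) :
  (TwAlg (base_tw_in x) : twist) \in base_pred twist.
Proof. by rewrite unfold_in /=; apply: thomog1; exact: base_in. Qed.

(* x |-> 1 (x) x, from A_e to the base algebra of alpha(A) *)
Definition base_tw (x : base A) : base twist := Base (base_tw_in1 x).

Lemma base_tw_inj : injective base_tw.
Proof.
move=> x y /(congr1 (fun z : base twist => tcoef 1%g (tw_val (base_val z)))) /=.
rewrite twgrp1E !ttens_bal !tcoef_basis eqxx => e; apply: val_inj.
by apply: (scalerI _ e); rewrite invr_eq0 cocycle2_neq0.
Qed.

Lemma base_tw_surj (y : base twist) : {x | base_tw x = y}.
Proof.
apply: cid; have /thomogP[a aA ey] := base_in y.
have a1 : alpha 1%g 1%g *: a \in base_pred A by rewrite rpredZ.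
exists (Base a1); do 2 apply: val_inj; rewrite /= [RHS]ey.
by rewrite -ttens_bal twgrp1E scalerA divff ?scale1r // cocycle2_neq0.
Qed.

(* The inverse of base_tw. *)
Definition base_untw (y : base twist) : base A := projT1 (base_tw_surj y).

Lemma base_untwK : cancel base_untw base_tw.
Proof. by move=> y; exact: (projT2 (base_tw_surj y)). Qed.

Lemma base_twK : cancel base_tw base_untw.
Proof. by move=> x; apply: base_tw_inj; exact: base_untwK. Qed.

Lemma base_twD x y : base_tw (x + y) = base_tw x + base_tw y.
Proof. by do 2 apply: val_inj; rewrite /= /ttens tensDr. Qed.
Lemma base_twM x y : base_tw (x * y) = base_tw x * base_tw y.
Proof. by do 2 apply: val_inj; rewrite /= [RHS]ttensM mulr1. Qed.
Lemma base_tw1 : base_tw 1 = 1.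
Proof. by do 2 apply: val_inj. Qed.

Lemma base_untwD x y : base_untw (x + y) = base_untw x + base_untw y.
Proof. by apply: base_tw_inj; rewrite base_twD !base_untwK. Qed.
Lemma base_untwM x y : base_untw (x * y) = base_untw x * base_untw y.
Proof. by apply: base_tw_inj; rewrite base_twM !base_untwK. Qed.
Lemma base_untw1 : base_untw 1 = 1.
Proof. by apply: base_tw_inj; rewrite base_tw1 base_untwK. Qed.

(* An A_e-module M, regarded as a module over the base algebra of alpha(A)
   through base_tw. *)
Definition twmod (M : lmodType (base A)) : Type := M.

Section TwMod.
Variable M : lmodType (base A).
HB.instance Definition _ := GRing.Zmodule.on (twmod M).

Definition twmod_scale (y : base twist) (m : twmod M) : twmod M :=
  base_untw y *: (m : M).

Lemma twmod_scaleA x y m : twmod_scale x (twmod_scale y m) = twmod_scale (x * y) m.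
Proof. by rewrite /twmod_scale scalerA base_untwM. Qed.
Lemma twmod_scale1 : left_id 1 twmod_scale.
Proof. by move=> m; rewrite /twmod_scale base_untw1 scale1r. Qed.
Lemma twmod_scaleDr : right_distributive twmod_scale +%R.
Proof. by move=> x m n; exact: scalerDr. Qed.
Lemma twmod_scaleDl m : {morph twmod_scale^~ m : x y / x + y}.
Proof. by move=> x y; rewrite /twmod_scale base_untwD; exact: scalerDl. Qed.

HB.instance Definition _ := GRing.Zmodule_isLmodule.Build (base twist) (twmod M)
  twmod_scaleA twmod_scale1 twmod_scaleDr twmod_scaleDl.

Definition twlmod : lmodType (base twist) := twmod M.
End TwMod.

End TwistedTensor.
Arguments twist {F G} alpha A.
Arguments twlmod {F G} alpha {A} M.

Section Irr.
Variables (F : fieldType) (R : algType F).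

Definition mod_iso (M N : lmodType R) : Prop :=
  exists f : {linear M -> N}, bijective f.

(* The isomorphism class of M. *)
Definition iso_class (M : lmodType R) : lmodType R -> Prop := mod_iso M.

Definition simple_mod (M : lmodType R) : Prop := (exists m : M, m != 0) /\
  forall S : {pred M}, GRing.submod_closed S ->
    (forall m, m \in S -> m = 0) \/ (forall m, m \in S).

(* End_R(M) = F Id_M, with F acting on M through c |-> c%:A; the inclusion of
   F Id_M in End_R(M) always holds. *)
Definition End_scalar (M : lmodType R) : Prop :=
  forall f : {linear M -> M}, exists c : F, forall m, f m = c%:A *: m.

(* Irr_F(R), as a set of isomorphism classes. *)
Definition Irr (C : lmodType R -> Prop) : Prop :=
  exists M : lmodType R, [/\ simple_mod M, End_scalar M & C = iso_class M].
End Irr.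
Arguments Irr {F} R C.

Section InvariantIrr.
Variables (F : fieldType) (G : groupType) (A : gradedAlg F G).

(* The classes in Irr_F(A_e) that are G-invariant with respect to A. *)
Definition Irr_inv (C : lmodType (base A) -> Prop) : Prop :=
  Irr (base A) C /\ forall M, C M -> G_invariant M.

(* The classes in Irr_F(A_e) that are G-invariant with respect to alpha(A). *)
Definition Irr_twist_inv (alpha : cocycle2 F G)
    (C : lmodType (base A) -> Prop) : Prop :=
  Irr (base A) C /\ forall M, C M -> G_invariant (twlmod alpha M).
End InvariantIrr.
Arguments Irr_inv {F G} A C.
Arguments Irr_twist_inv {F G} A alpha C.

(* Main.v *)
Require Import Defs.
From mathcomp Require Import all_boot all_algebra.
From HB Require Import structures.
From mathcomp Require Import boolp classical_sets.

Set Implicit Arguments.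
Unset Strict Implicit.
Unset Printing Implicit Defensive.

Import GRing.Theory.
Local Open Scope ring_scope.

(** Write [A'] for the twisted algebra and [sigma : A -> A'] for the additive
bijection that sends [a] in [A_g] to [v_g (x) a]; then
[sigma a * sigma b = alpha(g, h) sigma (a b)] for [a] in [A_g] and [b] in [A_h].
Accordingly [theta (a (x) m) = sigma a (x) m] defines a degree-preserving
additive bijection from [W = A (x)_(A_e) M] onto [A' (x)_(A_e) M] such that
  [sigma a . theta w = alpha(g, h) theta (a w)] for [a] in [A_g], [w] in [W_h].
Such a pair [(sigma, theta)] is called here a twisted isomorphism.

The heart of the proof is [twisted_iso_susp]: along a twisted isomorphism from
[W] to [W'], an isomorphism [f : W -> g(W)] of graded modules can be transported
to [W'].  The naive conjugate [theta f theta^-1] is not linear over [A'], since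
[f] moves degree [h] of [W] to degree [h g] of the underlying module and so
changes the cocycle factor from [alpha(k, h)] to [alpha(k, h g)].  Rescaling it
by [alpha(h, g)] in degree [h] repairs this, because the cocycle identity reads
  [alpha(k, h) alpha(k h, g) = alpha(k, h g) alpha(h, g)].

Twisted isomorphisms descend to the quotients by the largest graded submodules
with zero [e]-component ([twisted_iso_red]), because they match these submodules
([twisted_maxsub]).  The inverse of a twisted isomorphism is a twisted
isomorphism for the inverse cocycle ([twisted_iso_sym]), so that only one
inclusion of the inertia sets has to be proved.  Applied to the map [theta]
above ([gtens_twisted_iso]) this gives equality of the inertia sets, and the
statements on invariance follow formally. *)

(** * Additive maps determined by homogeneous elements *)

Section HomogeneousExtension.
Variables (G : groupType) (V : zmodType) (V_ : G -> {pred V}).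
Hypothesis ds : direct_sum V_.

Lemma homog_ext (Z : zmodType) (f g : V -> Z) :
    zmod_morphism f -> zmod_morphism g ->
    (forall h, {in V_ h, f =1 g}) ->
  f =1 g.
Proof.
move=> fB gB fg x; have [s [u [_ uV ->]]] := ds.1 x.
by rewrite !zmorph_sum //; apply: eq_bigr => h _; exact: fg.
Qed.

Hypothesis cl : forall g, GRing.zmod_closed (V_ g).
Variables (Z : zmodType) (phi : G -> V -> Z).
Hypothesis phiB : forall g, zmod_morphism (phi g).

Definition hsupp (x : V) : seq G := sval (cid (hproj_sum ds x)).

(** The additive map on the direct sum that restricts to [phi g] on [V_ g]. *)
Definition hglue (x : V) : Z := \sum_(g <- hsupp x) phi g (hproj ds g x).

(** The value does not depend on the chosen support: any list containing all
degrees where [x] has a nonzero component gives the same sum.  Additivity needs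
this to sum two elements and their difference over a common list. *)
Lemma hglueEw (d : seq G) x : uniq d ->
  (forall g, g \notin d -> hproj ds g x = 0) ->
  hglue x = \sum_(g <- d) phi g (hproj ds g x).
Proof.
move=> ud d0; have [us s0 _] := svalP (cid (hproj_sum ds x)).
have nz (s : seq G) : \sum_(g <- s) phi g (hproj ds g x) =
    \sum_(g <- s | hproj ds g x != 0) phi g (hproj ds g x).
  rewrite [RHS]big_mkcond; apply: eq_bigr => g _.
  by case: eqP => //= ->; rewrite zmorph0.
rewrite /hglue (nz (hsupp x)) (nz d) -big_filter -[RHS]big_filter.
apply: perm_big.
apply: uniq_perm; rewrite ?filter_uniq // => g; rewrite !mem_filter.
case: (eqVneq (hproj ds g x) 0) => //= x0; transitivity true.
  by apply: contraNT x0 => /s0 ->.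
by symmetry; apply: contraNT x0 => /d0 ->.
Qed.

Lemma hglueB : zmod_morphism hglue.
Proof.
move=> x y; pose d := undup (hsupp x ++ hsupp y).
have ud : uniq d by exact: undup_uniq.
have [_ sx _] := svalP (cid (hproj_sum ds x)).
have [_ sy _] := svalP (cid (hproj_sum ds y)).
have dx g : g \notin d -> hproj ds g x = 0.
  by rewrite mem_undup mem_cat negb_or => /andP[/sx].
have dy g : g \notin d -> hproj ds g y = 0.
  by rewrite mem_undup mem_cat negb_or => /andP[_ /sy].
rewrite !(hglueEw ud) // => [|g gd]; last first.
  by rewrite (hprojB cl) dx // dy // subrr.
by rewrite -sumrB; apply: eq_bigr => g _; rewrite (hprojB cl) phiB.
Qed.

Lemma hglueE g x : x \in V_ g -> hglue x = phi g x.
Proof.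
move=> xV; rewrite (@hglueEw [:: g]) => [|//|h].
  by rewrite big_seq1 (hproj_id cl ds g xV) eqxx.
by rewrite inE (hproj_id cl ds h xV) => /negbTE ->.
Qed.
End HomogeneousExtension.

(** * Twisted isomorphisms of graded modules *)

Section GradedBijection.
Variables (G : groupType) (V V' : zmodType).
Variables (V_ : G -> {pred V}) (V'_ : G -> {pred V'}).

Definition graded_bij (f : V -> V') (f' : V' -> V) : Prop :=
  [/\ zmod_morphism f, cancel f f', cancel f' f,
      forall g, {in V_ g, forall x, f x \in V'_ g}
    & forall g, {in V'_ g, forall y, f' y \in V_ g}].
End GradedBijection.

Lemma graded_bij_sym (G : groupType) (V V' : zmodType) (V_ : G -> {pred V})
    (V'_ : G -> {pred V'}) (f : V -> V') (f' : V' -> V) :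
  graded_bij V_ V'_ f f' -> graded_bij V'_ V_ f' f.
Proof.
move=> [fB fK f'K fV f'V]; split=> // x y.
by apply: (can_inj fK); rewrite f'K fB !f'K.
Qed.

Section InverseCocycle.
Variables (F : fieldType) (G : groupType) (gamma : cocycle2 F G).

Lemma cocycle2V_neq0 g h : (gamma g h)^-1 != 0.
Proof. by rewrite invr_eq0 cocycle2_neq0. Qed.

Lemma cocycle2VP g h k : (gamma g h)^-1 * (gamma (g * h)%g k)^-1
  = (gamma g (h * k)%g)^-1 * (gamma h k)^-1.
Proof. by rewrite -!invfM cocycle2P. Qed.

Definition cocycle2V : cocycle2 F G := Cocycle2 cocycle2V_neq0 cocycle2VP.
End InverseCocycle.

Section ScalarAction.
Variables (F : fieldType) (G : groupType) (A : gradedAlg F G).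

Lemma alg_scalerA (W : lmodType A) (c d : F) (w : W) :
  c%:A *: (d%:A *: w) = (c * d)%:A *: w.
Proof. by rewrite scalerA mulr_algl scalerA. Qed.

Lemma alg_scalerC (W : lmodType A) (c : F) (a : A) (w : W) :
  a *: (c%:A *: w) = c%:A *: (a *: w).
Proof. by rewrite !scalerA mulr_algl mulr_algr. Qed.

Lemma alg_scale_in (W : gradedMod A) (c : F) g (w : W) :
  w \in mcomp g -> c%:A *: w \in mcomp (g : G).
Proof.
have cA : c%:A \in gcomp A 1%g by rewrite rpredZ ?gcomp1.
by move=> /(mcompZ cA); rewrite mul1g.
Qed.
End ScalarAction.

Section TwistedIsomorphism.
Variables (F : fieldType) (G : groupType).

(** Twisting the action by a cocycle, stated for modules over two different algebras
so that it can be read in both directions: the inverses [tau] and [eta] belong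
to the data because exchanging them with [sigma] and [theta] inverts the cocycle.
As a model, [sigma] is [a |-> v_g (x) a] on [A_g], which fails to be
multiplicative exactly by the factor that appears in [tiso_act]. *)
Record twisted_iso (gamma : cocycle2 F G) (A A' : gradedAlg F G)
    (W : gradedMod A) (W' : gradedMod A')
    (sigma : A -> A') (tau : A' -> A) (theta : W -> W') (eta : W' -> W) :
    Prop :=
  TwistedIso {
    tiso_alg : graded_bij (gcomp A) (gcomp A') sigma tau;
    tiso_mod : graded_bij (@mcomp _ _ _ W) (@mcomp _ _ _ W') theta eta;
    tiso_scale : forall (c : F) w, theta (c%:A *: w) = c%:A *: theta w;
    tiso_act : forall g h, {in gcomp A g & @mcomp _ _ _ W h, forall a w,
      sigma a *: theta w = (gamma g h)%:A *: theta (a *: w)}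
  }.

Lemma twisted_iso_sym (gamma : cocycle2 F G) (A A' : gradedAlg F G)
    (W : gradedMod A) (W' : gradedMod A') (sigma : A -> A') (tau : A' -> A)
    (theta : W -> W') (eta : W' -> W) :
  twisted_iso gamma sigma tau theta eta ->
  twisted_iso (cocycle2V gamma) tau sigma eta theta.
Proof.
move=> [sigmaP thetaP thetaZ thetaA].
have [_ _ tauK _ tau_in] := sigmaP.
have [_ thetaK etaK _ eta_in] := thetaP.
have etaZ (c : F) w : eta (c%:A *: w) = c%:A *: eta w.
  by apply: (can_inj thetaK); rewrite etaK thetaZ etaK.
split=> //; try exact: graded_bij_sym.
move=> g h a w aA wW; have := thetaA g h _ _ (tau_in g a aA) (eta_in h w wW).
rewrite tauK etaK => ->; rewrite etaZ thetaK alg_scalerA /=.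
by rewrite mulVf ?cocycle2_neq0 // scale1r scale1r.
Qed.

Section Transfer.
Variables (gamma : cocycle2 F G) (A A' : gradedAlg F G).
Variables (W : gradedMod A) (W' : gradedMod A').
Variables (sigma : A -> A') (tau : A' -> A) (theta : W -> W') (eta : W' -> W).
Hypothesis iso : twisted_iso gamma sigma tau theta eta.

Let sigmaP := tiso_alg iso.
Let thetaP := tiso_mod iso.

(** The image under [theta] of a graded submodule [S] with zero [e]-component is
again one: on homogeneous elements the two actions differ by scalars only, and
a graded submodule is generated by its homogeneous elements. *)
Lemma twisted_maxsub (w : W) :
  w \in @maxsub _ _ _ W -> theta w \in @maxsub _ _ _ W'.
Proof.
have [_ _ tauK _ tau_in] := sigmaP.
have [thetaB thetaK etaK theta_in eta_in] := thetaP.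
have [etaB _ _ _ _] := graded_bij_sym thetaP.
move=> /maxsubP[S [[Scl Sgr] Se wS]].
pose S' : {pred W'} := fun y => eta y \in S.
have S'E y : (y \in S') = (eta y \in S) by [].
have [S0 _] := Scl.
have SB := (GRing.submod_closedB Scl).2.
have SD x y : x \in S -> y \in S -> x + y \in S.
  by move=> xS yS; rewrite -[y]opprK; rewrite SB // -sub0r SB.
have SZ a x : x \in S -> a *: x \in S.
  by move=> xS; rewrite -[_ *: _]addr0; apply: Scl.2.
have S'Z (a : A') y : y \in S' -> a *: y \in S'.
  (* Both the scalar and the vector are split into homogeneous components, where
     [tiso_act] applies. *)
  rewrite !S'E -{2}[y]etaK => yS; have [s [f [_ fS ->]]] := Sgr _ yS.
  have [r [b [_ bA ->]]] := (gcomp_sum A').1 a.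
  rewrite (zmorph_sum thetaB) scaler_suml (zmorph_sum etaB).
  apply: (big_ind (fun x => x \in S)) => // k _.
  rewrite scaler_sumr (zmorph_sum etaB).
  apply: (big_ind (fun x => x \in S)) => // h _.
  have /andP[fhS fhW] := fS h.
  rewrite -[b k]tauK (tiso_act iso (tau_in k _ (bA k)) fhW).
  by rewrite -(tiso_scale iso) thetaK !SZ.
apply/maxsubP; exists S'; split; last by rewrite S'E thetaK.
- split.
    split; first by rewrite S'E (zmorph0 etaB).
    move=> a x y xS yS; rewrite S'E (zmorphD etaB) SD //.
    exact: S'Z.
  move=> y /Sgr[s [f [us fS ey]]]; exists s, (fun g => theta (f g)); split=> //.
    move=> g; have /andP[fgS fgW] := fS g; apply/andP; split.
      by rewrite S'E thetaK.
    exact: theta_in.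
  by rewrite -(zmorph_sum thetaB) -ey etaK.
- move=> y yS /eta_in yW; apply: (can_inj etaK).
  by rewrite (zmorph0 etaB) [LHS](Se _ yS yW).
Qed.

(** Multiplication by [c h] on the component of degree [h]. *)
Definition diag_twist (c : G -> F) : W' -> W' :=
  hglue (mcomp_sum W') (fun h w => (c h)%:A *: w).

Let scaleB (c : G -> F) h : zmod_morphism (fun w : W' => (c h)%:A *: w).
Proof. by move=> x y; rewrite scalerBr. Qed.

Lemma diag_twistB c : zmod_morphism (diag_twist c).
Proof. exact: (hglueB _ (mcomp_closed W') (scaleB c)). Qed.

Lemma diag_twistE c h w : w \in mcomp h -> diag_twist c w = (c h)%:A *: w.
Proof. exact: (hglueE _ (mcomp_closed W') (scaleB c)). Qed.

Lemma diag_twistK c c' : (forall h, c' h * c h = 1) ->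
  cancel (diag_twist c) (diag_twist c').
Proof.
move=> cc'; apply: (homog_ext (mcomp_sum W') (g := id)) => // [|h w wW].
  exact: (zmorph_comp (diag_twistB c') (diag_twistB c)).
rewrite (diag_twistE _ wW) (diag_twistE _ (alg_scale_in _ wW)) alg_scalerA cc'.
by rewrite scale1r scale1r.
Qed.

(** Transport of [f : W -> g(W)] along [theta]: the linear map on [W'] is
[theta w |-> gamma(h, g) theta (f w)] for [w] in [W_h]. *)
Lemma twisted_iso_susp g : gmod_iso W (susp W g) -> gmod_iso W' (susp W' g).
Proof.
have [_ _ tauK _ tau_in] := sigmaP.
have [thetaB thetaK etaK theta_in eta_in] := thetaP.
have [etaB _ _ _ _] := graded_bij_sym thetaP.
have etaZ := tiso_scale (twisted_iso_sym iso).
move=> [f [[f' fK f'K] f_in]].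
have fB : zmod_morphism f by exact: raddfB.
pose D := diag_twist (fun h => gamma h g).
pose D' := diag_twist (fun h => (gamma h g)^-1).
have DK : cancel D D'.
  by apply: diag_twistK => h; rewrite mulVf // cocycle2_neq0.
have D'K : cancel D' D.
  by apply: diag_twistK => h; rewrite mulfV // cocycle2_neq0.
have DB : zmod_morphism D by exact: diag_twistB.
pose q (y : W') : susp W' g := theta (f (eta (D y))).
have qB : zmod_morphism q.
  by move=> x y; rewrite /q DB etaB fB thetaB.
have qE h w : w \in mcomp h -> q (theta w) = (gamma h g)%:A *: theta (f w).
  move=> wW; rewrite /q /D (diag_twistE _ (theta_in _ _ wW)) etaZ thetaK.
  by rewrite linearZ (tiso_scale iso).
have qZ (a : A') y : q (a *: y) = a *: q y.
  apply: (homog_ext (gcomp_sum A') (f := fun a => q (a *: y))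
    (g := fun a => a *: q y)) a => [u v|u v|k a aA].
  - by rewrite scalerBl qB.
  - by rewrite scalerBl.
  apply: (homog_ext (mcomp_sum W') (f := fun y => q (a *: y))
    (g := fun y => a *: q y)) y => [u v|u v|h y yW].
  - by rewrite scalerBr qB.
  - by rewrite qB scalerBr.
  have bA := tau_in _ _ aA; have wW := eta_in _ _ yW.
  rewrite -[a]tauK -[y]etaK; set b := tau a in bA *; set w := eta y in wW *.
  have fwW := f_in _ _ wW.
  rewrite (tiso_act iso bA wW) -(tiso_scale iso).
  rewrite (qE (k * h)%g); last by apply: alg_scale_in; exact: mcompZ.
  rewrite (qE h) // alg_scalerC [in RHS](tiso_act iso bA fwW).
  (* What remains is gamma(kh, g) gamma(k, h) = gamma(h, g) gamma(k, hg). *)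
  rewrite !linearZ /= (tiso_scale iso) !alg_scalerA; congr (_%:A *: _).
  by rewrite mulrC cocycle2P mulrC.
pose ql : {linear W' -> susp W' g} := HB.pack q
  (GRing.isZmodMorphism.Build _ _ q qB)
  (GRing.isScalable.Build _ _ _ _ q qZ).
exists ql; split.
  exists (fun y => D' (theta (f' (eta y)))) => y.
    by rewrite /= /q thetaK fK etaK DK.
  by rewrite /= /q D'K thetaK f'K etaK.
move=> h y yW; have wW := eta_in _ _ yW; rewrite -[y]etaK /= (qE h) //.
by apply: alg_scale_in; apply: theta_in; exact: f_in.
Qed.
End Transfer.

Local Notation redpi W :=
  (\pi_(Quotient.quot (@maxsub _ _ _ W))%qT : _ -> red W).

Definition red_map (A A' : gradedAlg F G) (W : gradedMod A) (W' : gradedMod A')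
    (theta : W -> W') (x : red W) : red W' :=
  redpi W' (theta (repr x)).

Section Reduction.
Variables (gamma : cocycle2 F G) (A A' : gradedAlg F G).
Variables (W : gradedMod A) (W' : gradedMod A').
Variables (sigma : A -> A') (tau : A' -> A) (theta : W -> W') (eta : W' -> W).
Hypothesis iso : twisted_iso gamma sigma tau theta eta.

Lemma red_mapE w : red_map theta (redpi W w) = redpi W' (theta w).
Proof.
have [thetaB _ _ _ _] := tiso_mod iso.
apply/eqP; rewrite -Quotient.idealrBE -thetaB (twisted_maxsub iso) //.
by rewrite Quotient.idealrBE reprK.
Qed.
End Reduction.

Lemma twisted_iso_red (gamma : cocycle2 F G) (A A' : gradedAlg F G)
    (W : gradedMod A) (W' : gradedMod A') (sigma : A -> A') (tau : A' -> A)
    (theta : W -> W') (eta : W' -> W) :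
  twisted_iso gamma sigma tau theta eta ->
  twisted_iso gamma sigma tau (red_map theta) (red_map eta).
Proof.
move=> iso; have iso' := twisted_iso_sym iso.
have [thetaB thetaK etaK theta_in eta_in] := tiso_mod iso.
have mapE := red_mapE iso; have mapE' := red_mapE iso'.
have scaleE (V : gradedMod A) (a : A) x :
    a *: redpi V x = redpi V (a *: x).
  exact: red_scaleE.
have scaleE' (V : gradedMod A') (a : A') x :
    a *: redpi V x = redpi V (a *: x).
  exact: red_scaleE.
split; first exact: (tiso_alg iso).
- split.
  + move=> x y; rewrite -[x]reprK -[y]reprK -raddfB !mapE.
    by rewrite thetaB raddfB.
  + by move=> x; rewrite -[x]reprK mapE mapE' thetaK.
  + by move=> x; rewrite -[x]reprK mapE' mapE etaK.
  + move=> g _ /red_compP[w wW ->]; rewrite mapE; apply/red_compP.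
    by exists (theta w) => //; exact: theta_in.
  + move=> g _ /red_compP[w wW ->]; rewrite mapE'; apply/red_compP.
    by exists (eta w) => //; exact: eta_in.
- move=> c x; rewrite -[x]reprK scaleE !mapE scaleE'.
  by rewrite (tiso_scale iso).
- move=> g h a _ aA /red_compP[w wW ->]; rewrite scaleE !mapE !scaleE'.
  by rewrite (tiso_act iso aA wW).
Qed.

End TwistedIsomorphism.

(** * The twisted algebra and its induced modules *)

Section Twist.
Variables (F : fieldType) (G : groupType) (alpha : cocycle2 F G).
Variable A : gradedAlg F G.

Local Notation A' := (twist alpha A).

Lemma twist_homog_in g (a : A) :
  ttens (Defs.vbasis alpha g) (hproj (gcomp_sum A) g a)
    \in @thomog _ _ alpha A g.
Proof.
apply/thomogP; exists (hproj (gcomp_sum A) g a) => //.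
exact: (hproj_in (gcomp_zmod A)).
Qed.

(** The element [v_g (x) a] lies in the twisted algebra only for [a] in [A_g];
projecting to [A_g] first makes the map total. *)
Definition twist_homog g (a : A) : A' := TwAlg (thomog_tw (twist_homog_in g a)).

(** The map [sigma] that sends [a] in [A_g] to [v_g (x) a]. *)
Definition to_twist : A -> A' := hglue (gcomp_sum A) twist_homog.

Definition of_twist : A' -> A :=
  hglue (gcomp_sum A') (fun g (x : A') => tcoef g (tw_val x)).

Let twist_homogB g : zmod_morphism (twist_homog g).
Proof.
move=> x y; apply: val_inj.
by rewrite raddfB /= (hprojB (gcomp_zmod A)) /ttens tensBr.
Qed.

Lemma to_twistB : zmod_morphism to_twist.
Proof. exact: (hglueB _ (gcomp_zmod A) twist_homogB). Qed.

Lemma to_twistE g a : a \in gcomp A g ->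
  tw_val (to_twist a) = ttens (Defs.vbasis alpha g) a.
Proof.
move=> aA; rewrite /to_twist (hglueE _ (gcomp_zmod A) twist_homogB aA) /=.
by rewrite (hproj_id (gcomp_zmod A) _ g aA) eqxx.
Qed.

Let coefB g : zmod_morphism (fun x : A' => tcoef g (tw_val x)).
Proof. by move=> x y; rewrite -[tw_val _]/(val (x - y)) raddfB tcoefB. Qed.

Lemma of_twistB : zmod_morphism of_twist.
Proof. exact: (hglueB _ (gcomp_zmod A') coefB). Qed.

Lemma to_twist_in g a : a \in gcomp A g -> to_twist a \in gcomp A' g.
Proof.
by move=> aA; rewrite unfold_in /= (to_twistE aA); apply/thomogP; exists a.
Qed.

Lemma of_twistE g x a : a \in gcomp A g ->
  tw_val x = ttens (Defs.vbasis alpha g) a -> of_twist x = a.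
Proof.
move=> aA ex; rewrite /of_twist (hglueE _ (gcomp_zmod A') coefB (g := g)).
  by rewrite ex tcoef_basis eqxx.
by rewrite unfold_in /= ex; apply/thomogP; exists a.
Qed.

Lemma to_twist_bij : graded_bij (gcomp A) (gcomp A') to_twist of_twist.
Proof.
split.
- exact: to_twistB.
- apply: (homog_ext (gcomp_sum A) (g := id)) => // [|g a aA].
    exact: (zmorph_comp of_twistB to_twistB).
  by apply: (of_twistE aA); exact: to_twistE.
- apply: (homog_ext (gcomp_sum A') (g := id)) => // [|g x].
    exact: (zmorph_comp to_twistB of_twistB).
  move=> /thomogP[a aA ex]; apply: val_inj; rewrite (of_twistE aA ex) ex.
  exact: to_twistE.
- by move=> g a; exact: to_twist_in.
- by move=> g x /thomogP[a aA ex]; rewrite (of_twistE aA ex).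
Qed.

Lemma to_twistZ c a : to_twist (c *: a) = c *: to_twist a.
Proof.
apply: (homog_ext (gcomp_sum A) (f := fun a => to_twist (c *: a))
  (g := fun a => c *: to_twist a)) a => [x y|x y|g a aA].
- by rewrite scalerBr to_twistB.
- by rewrite to_twistB scalerBr.
apply: val_inj; rewrite linearZ /= !(to_twistE (g := g)) ?rpredZ //.
by rewrite ttensZ ttens_bal.
Qed.

Lemma to_twistM g h a b : a \in gcomp A g -> b \in gcomp A h ->
  to_twist a * to_twist b = alpha g h *: to_twist (a * b).
Proof.
move=> aA bA; apply: val_inj; rewrite rmorphM linearZ /=.
rewrite (to_twistE aA) (to_twistE bA) (to_twistE (gcompM aA bA)).
by rewrite ttensM vbasisM ttensZ.
Qed.

(** Since [base_tw x] is [1 (x) x], with 1 the unit of the twisted group algebra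
and not [v_e], right multiplication by the base algebra meets no cocycle factor.
This is what makes [a (x) m |-> to_twist a (x) m] balanced. *)
Lemma to_twist_base a (x : base A) :
  to_twist (a * base_val x) = to_twist a * base_val (base_tw alpha x).
Proof.
apply: (homog_ext (gcomp_sum A) (f := fun a => to_twist (a * base_val x))
  (g := fun a => to_twist a * base_val (base_tw alpha x))) a
  => [u v|u v|g a aA].
- by rewrite mulrBl to_twistB.
- by rewrite to_twistB mulrBl.
have axA : a * base_val x \in gcomp A g.
  by rewrite -[g]mulg1; apply: gcompM => //; exact: base_in.
apply: val_inj; rewrite rmorphM /= (to_twistE aA) (to_twistE axA).
by rewrite ttensM mulr1.
Qed.

Lemma of_twist_base (y : A') (b : base A') :
  of_twist (y * base_val b) = of_twist y * base_val (base_untw b).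
Proof.
have [_ toK ofK _ _] := to_twist_bij.
by apply: (can_inj toK); rewrite to_twist_base base_untwK !ofK.
Qed.

Section InducedModule.
Variable M : lmodType (base A).

Definition gtens_to : gtens M -> gtens (twlmod alpha M) :=
  tlift (fun (a : A) (m : M) => itens (to_twist a) (m : twlmod alpha M)).

Definition gtens_of : gtens (twlmod alpha M) -> gtens M :=
  tlift (fun (y : A') (m : twlmod alpha M) => itens (of_twist y) (m : M)).

Let to_bal : balanced (fun (a : A) (x : base A) => a * base_val x)
  (fun (x : base A) (m : M) => x *: m)
  (fun (a : A) (m : M) => itens (to_twist a) (m : twlmod alpha M)).
Proof.
split=> [m a b|a m n|a x m].
- by rewrite to_twistB /itens tensBl.
- exact: tensBr.
- rewrite to_twist_base /itens tens_bal; congr (tens _ _ _ _).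
  by rewrite /GRing.scale /= /twmod_scale base_twK.
Qed.

Let of_bal : balanced (fun (y : A') (b : base A') => y * base_val b)
  (fun (b : base A') (m : twlmod alpha M) => b *: m)
  (fun (y : A') (m : twlmod alpha M) => itens (of_twist y) (m : M)).
Proof.
split=> [m y z|y m n|y b m].
- by rewrite of_twistB /itens tensBl.
- exact: tensBr.
- by rewrite of_twist_base /itens tens_bal.
Qed.

Lemma gtens_toB : zmod_morphism gtens_to.
Proof. exact: (tliftB to_bal). Qed.

Lemma gtens_toE a (m : M) :
  gtens_to (itens a m) = itens (to_twist a) (m : twlmod alpha M).
Proof. exact: (tliftE to_bal). Qed.

Lemma gtens_ofB : zmod_morphism gtens_of.
Proof. exact: (tliftB of_bal). Qed.

Lemma gtens_ofE y (m : twlmod alpha M) :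
  gtens_of (itens y m) = itens (of_twist y) (m : M).
Proof. exact: (tliftE of_bal). Qed.

Lemma gtens_bij : graded_bij (@mcomp _ _ _ (gtens M))
  (@mcomp _ _ _ (gtens (twlmod alpha M))) gtens_to gtens_of.
Proof.
have [_ toK ofK to_in of_in] := to_twist_bij.
split.
- exact: gtens_toB.
- apply: (tens_ext (g := id)) => // [|a m].
    exact: (zmorph_comp gtens_ofB gtens_toB).
  by rewrite -/(itens a m) gtens_toE gtens_ofE toK.
- apply: (tens_ext (g := id)) => // [|y m].
    exact: (zmorph_comp gtens_toB gtens_ofB).
  by rewrite -/(itens y m) gtens_ofE gtens_toE ofK.
- move=> g; apply: zspan_ind => [|s t sW tW|_ [a aA [m ->]]].
  + by rewrite (zmorph0 gtens_toB) rpred0.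
  + by rewrite gtens_toB rpredB.
  + apply: zspan_gen; exists (to_twist a); first exact: to_in.
    by exists m; exact: gtens_toE.
- move=> g; apply: zspan_ind => [|s t sW tW|_ [y yA [m ->]]].
  + by rewrite (zmorph0 gtens_ofB) rpred0.
  + by rewrite gtens_ofB rpredB.
  + apply: zspan_gen; exists (of_twist y); first exact: of_in.
    by exists m; exact: gtens_ofE.
Qed.

Lemma gtens_toZ (c : F) (t : gtens M) :
  gtens_to (c%:A *: t) = c%:A *: gtens_to t.
Proof.
apply: (tens_ext (f := fun t : gtens M => gtens_to (c%:A *: t))
  (g := fun t : gtens M => c%:A *: gtens_to t)) t => [s t|s t|a m].
- by rewrite scalerBr gtens_toB.
- by rewrite gtens_toB scalerBr.
rewrite -/(itens a m) gtens_toE.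
have -> : c%:A *: (itens a m : gtens M) = itens (c%:A * a) m.
  exact: ind_scaleE.
rewrite gtens_toE mulr_algl to_twistZ -[c *: to_twist a]mulr_algl.
symmetry; exact: ind_scaleE.
Qed.

Lemma gtens_twisted_iso :
  twisted_iso alpha to_twist of_twist gtens_to gtens_of.
Proof.
split; [exact: to_twist_bij | exact: gtens_bij | exact: gtens_toZ |].
move=> g h a t aA.
move: t; apply: zspan_ind => [|s t es et|_ [b bA [m ->]]].
- by rewrite !scaler0 (zmorph0 gtens_toB) !scaler0.
- by rewrite scalerBr !gtens_toB !scalerBr es et.
have scaleE (c : A) : c *: (itens b m : gtens M) = itens (c * b) m.
  exact: ind_scaleE.
have scaleE' (y z : A') :
    y *: (itens z (m : twlmod alpha M) : gtens (twlmod alpha M)) =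
    itens (y * z) (m : twlmod alpha M).
  exact: ind_scaleE.
rewrite scaleE !gtens_toE !scaleE' (to_twistM aA bA).
by rewrite mulr_algl.
Qed.

(** The two inclusions are the transport along the twisted isomorphism of the
reduced induced modules and along its inverse. *)
Lemma inertia_twist : inertia M = inertia (twlmod alpha M).
Proof.
apply/funext => g; apply/propext; split.
  exact: (twisted_iso_susp (twisted_iso_red gtens_twisted_iso)).
exact: (twisted_iso_susp (twisted_iso_sym (twisted_iso_red gtens_twisted_iso))).
Qed.
End InducedModule.
End Twist.

Theorem proposition5p20 (F : fieldType) (G : groupType) (A : gradedAlg F G) :
  [/\ forall (M : lmodType (base A)) (alpha : cocycle2 F G),
        inertia M = inertia (twlmod alpha M),
      forall (M : lmodType (base A)) (alpha : cocycle2 F G),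
        G_invariant M <-> G_invariant (twlmod alpha M)
    & forall alpha : cocycle2 F G, Irr_inv A = Irr_twist_inv A alpha].
Proof.
have invE (M : lmodType (base A)) (alpha : cocycle2 F G) :
    G_invariant M = G_invariant (twlmod alpha M).
  by rewrite /G_invariant (inertia_twist alpha).
split=> [M alpha|M alpha|alpha]; first exact: inertia_twist.
  by rewrite (invE M alpha).
apply/funext => C; apply/propext; split=> -[irrC invC]; split=> // M /invC.
  by rewrite (invE M alpha).
by rewrite -(invE M alpha).
Qed.
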